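(* Let $n\ge 2$. The functional $$\Phi(S,u)=\frac{2}{\omega_n}\int_{S}\langle \theta,u\rangle\,d\sigma(\theta),$$ defined on the set of pairs $(S,u)$ with $S\in\mathcal{C}$ and $u\in S^*$, attains a minimum, and this minimum is strictly positive. Moreover, the minimum is attained at a pair $(S_0,v)$ in which $S_0$ is self-dual ($S_0=S_0^*$) and $v\in\partial S_0$ (boundary relative to $S^{n-1}$).
   Context: $S^{n-1}$ is the unit sphere of $\mathbb{R}^n$, $\sigma$ is the spherical Lebesgue measure on it, and $\omega_n=2\pi^{n/2}/\Gamma(n/2)$ is the measure of $S^{n-1}$. A sector is a set of the form $N\cap S^{n-1}$ with $N$ a closed convex cone of $\mathbb{R}^n$, i.e. a closed convex subset of the sphere. The dual of a sector $S$ is $S^*=\{y\in S^{n-1}:\langle y,x\rangle\ge 0\ \forall x\in S\}$, and $S$ is self-dual if $S^*=S$. $\mathcal{C}$ denotes the class of sectors $S\subset S^{n-1}$ with $S\supseteq S^*$. Note that for $u\in S^*$ the integrand $\langle\theta,u\rangle$ is nonnegative on $S$. Sectors are compared with the Hausdorff distance. *)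

(* Defs.v *)
From HB Require Import structures.
From mathcomp Require Import all_boot all_order all_algebra.
From mathcomp Require Import all_classical all_reals all_analysis.
Set Implicit Arguments. Unset Strict Implicit. Unset Printing Implicit Defensive.
Import Order.TTheory GRing.Theory Num.Theory.
Import numFieldNormedType.Exports.
Local Open Scope classical_set_scope.
Local Open Scope ring_scope.

Section Defs.
Variable R : realType.

Definition dotp (n : nat) (x y : 'rV[R]_n) : R := \sum_(i < n) x ord0 i * y ord0 i.
Definition enorm (n : nat) (x : 'rV[R]_n) : R := Num.sqrt (dotp x x).

Definition sphere (n : nat) : set 'rV[R]_n := [set x | enorm x = 1].

Definition is_cone (n : nat) (N : set 'rV[R]_n) : Prop :=
  forall x t, N x -> 0 <= t -> N (t *: x).
Definition is_convex (n : nat) (N : set 'rV[R]_n) : Prop :=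
  forall x y t, N x -> N y -> 0 <= t <= 1 -> N (t *: x + (1 - t) *: y).
Definition is_sector (n : nat) (S : set 'rV[R]_n) : Prop :=
  exists N : set 'rV[R]_n,
    [/\ closed N, is_convex N, is_cone N & S = N `&` @sphere n].
Definition dual (n : nat) (S : set 'rV[R]_n) : set 'rV[R]_n :=
  [set y | @sphere n y /\ forall x, S x -> 0 <= dotp y x].
Definition classC (n : nat) (S : set 'rV[R]_n) : Prop :=
  is_sector S /\ dual S `<=` S.

(* boundary of S relative to the sphere (for S closed: points of S that are
   limits of points of the sphere outside S) *)
Definition rel_boundary (n : nat) (S : set 'rV[R]_n) : set 'rV[R]_n :=
  S `&` closure (@sphere n `\` S).

(* Iterated Lebesgue integral over R^n: coordinates k = n-1, ..., 0 are
   integrated one at a time (by Tonelli this is the Lebesgue integral on R^n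
   for nonnegative Borel functions). *)
Fixpoint iint (n : nat) : ((nat -> R) -> \bar R) -> \bar R :=
  match n with
  | 0 => fun g => g (fun _ => 0)
  | k.+1 => fun g =>
      (\int[@lebesgue_measure R]_(t in [set: R])
         iint k (fun x => g (fun i => if i == k then t else x i)))%E
  end.

Definition lebesgue_int (n : nat) (f : 'rV[R]_n -> \bar R) : \bar R :=
  iint n (fun x => f (\row_(i < n) x (nat_of_ord i))).

(* Integral over a subset A of the sphere w.r.t. the spherical Lebesgue
   measure sigma, defined as the cone measure:
   sigma(B) = n * lambda_n {x | 0 < |x| <= 1, x/|x| \in B},
   i.e. sigma = n * pushforward of lambda_n|(B^n \ 0) by x |-> x/|x|. *)
Definition sphere_int (n : nat) (A : set 'rV[R]_n) (f : 'rV[R]_n -> \bar R)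
  : \bar R :=
  ((n%:R)%:E * lebesgue_int (fun x =>
     if `[< (0 < enorm x <= 1)%R /\ A ((enorm x)^-1 *: x)%R >]
     then f ((enorm x)^-1 *: x)%R else 0))%E.

Definition omega (n : nat) : R := fine (sphere_int (@sphere n) (fun _ => 1%E)).

Definition Phi (n : nat) (S : set 'rV[R]_n) (u : 'rV[R]_n) : R :=
  2 / @omega n * fine (sphere_int S (fun th => (dotp th u)%:E)).

End Defs.

(* Main.v *)
Require Import Defs.
From HB Require Import structures.
From mathcomp Require Import all_boot all_order all_algebra.
From mathcomp Require Import all_classical all_reals all_analysis.
From mathcomp Require Import measurable_realfun ring lra.
Import Order.TTheory GRing.Theory Num.Theory.
Import numFieldNormedType.Exports.
Local Open Scope classical_set_scope.
Local Open Scope ring_scope.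
Set Implicit Arguments. Unset Strict Implicit. Unset Printing Implicit Defensive.

(* If S contains its dual, a maximal set A of unit vectors with pairwise
   nonnegative inner products and A containing S^* is self-dual and satisfies
   A <= S^** = S, so it suffices to minimize over self-dual S and u in S.
   Take a minimizing sequence (S_k, u_k) and a free ultrafilter U. The set S0 of
   U-limits of points of the cones over S_k is self-dual, by the decomposition
   y = p - q with p, q orthogonal and in the cone over S_k. By compactness, for
   each m the set where <x, z> >= |x| / (m + 1) for all z in S0 lies in S_k for
   U-almost all k, and these sets exhaust S0 up to a null set; hence S0 with the
   U-limit of u_k realizes the infimum. Finally, if v were interior to S0, moving
   it to both sides along a great circle would decrease the linear functional
   u |-> int_S0 <theta, u>, which is positive at v, on at least one side. *)

(** * Lebesgue measure on row vectors *)

Section coordinates.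
Variable R : realType.

(** [iint] evaluates its argument on full sequences [nat -> R], so the measure representing it is
    built on sequences, with the sigma-algebra generated by the coordinates. *)
Definition cylinders : set (set (nat -> R)) :=
  [set A | exists i (B : set R), measurable B /\ A = (fun x => x i) @^-1` B].

Definition coords := g_sigma_algebraType cylinders.
HB.instance Definition _ := Measurable.on coords.

Lemma measurable_coord (i : nat) :
  measurable_fun setT (fun x : coords => x i : measurableTypeR R).
Proof.
move=> _ B mB; rewrite setTI; apply: sub_sigma_algebra.
by exists i, B.
Qed.

Lemma measurable_fun_coords d (T : measurableType d) (f : T -> coords) :
  (forall i, measurable_fun setT (fun t => f t i : measurableTypeR R)) ->
  measurable_fun setT f.
Proof.
move=> mf; apply: (@measurability _ _ _ _ setT f cylinders) => //.
move=> _ [_ [i [B [mB ->]]] <-].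
exact: mf.
Qed.

(** The substitution made by the successor case of [iint]: the outermost variable becomes coordinate
    [k]. *)
Definition upd (k : nat) (p : measurableTypeR R * coords) : coords :=
  fun i => if i == k then p.1 else p.2 i.

Lemma measurable_upd k : measurable_fun setT (upd k).
Proof.
apply: measurable_fun_coords => i; rewrite /upd.
case: (i == k); first exact: measurable_fst.
apply: (measurableT_comp (measurable_coord i)); exact: measurable_snd.
Qed.

Definition shift (v x : coords) : coords := fun i => x i + v i.

Lemma measurable_shift v : measurable_fun setT (shift v).
Proof.
apply: measurable_fun_coords => i.
by apply: measurable_funD => //; exact: measurable_coord.
Qed.

Definition box (n : nat) (a b : coords) : set coords :=
  [set x | forall i, (i < n)%N -> a i <= x i <= b i].

Lemma measurable_box n a b : measurable (box n a b).
Proof.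
have -> : box n a b = \bigcap_(i in `I_n) ((fun x : coords => x i) @^-1` `[a i, b i]).
  by apply/seteqP; split => x h i /= /h; rewrite /= in_itv.
apply: bigcap_measurableType => // i _; rewrite -[X in measurable X]setTI.
exact: (measurable_coord i).
Qed.

(** By uniqueness of Lebesgue measure, it is enough that the translated measure gives each half-open
    interval its length. *)
Lemma lebesgue_measure_shift (c : R) (A : set R) : measurable A ->
  pushforward lebesgue_measure ((fun t => t + c) : measurableTypeR R -> measurableTypeR R) A =
  lebesgue_measure A.
Proof.
have mc : measurable_fun setT ((fun t => t + c) : measurableTypeR R -> measurableTypeR R).
  by apply: measurable_funD.
move=> mA; apply/esym/lebesgue_measure_unique => // _ [[a b]] _ <-.
rewrite /pushforward.
rewrite [X in _ = lebesgue_measure X](_ : _ = [set` `]a - c, b - c]]); last first.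
  by apply/seteqP; split => t /=; rewrite !in_itv /=; lra.
rewrite /= !lebesgue_measure_itv /= !lte_fin ltrD2r.
by case: ifP => // _; rewrite -!EFinB; congr (_%:E); ring.
Qed.

Lemma ge0_integral_lebesgue_shift (c : R) (f : measurableTypeR R -> \bar R) :
  measurable_fun setT f -> (forall t, 0 <= f t)%E ->
  (\int[lebesgue_measure]_t f (t + c)%R = \int[lebesgue_measure]_t f t)%E.
Proof.
move=> mf f0.
have mc : measurable_fun setT ((fun t => t + c) : measurableTypeR R -> measurableTypeR R).
  by apply: measurable_funD.
have := ge0_integral_pushforward mc lebesgue_measure measurableT mf (fun y _ => f0 y).
rewrite preimage_setT => <-.
apply: eq_measure_integral => //= A mA _.
exact: lebesgue_measure_shift.
Qed.

(** Lebesgue measure on the first [n] coordinates, those beyond being frozen at 0; this is why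
    invariance is claimed only for translations vanishing beyond [n]. *)
Definition is_coord_lebesgue n (m : {measure set coords -> \bar R}) :=
  [/\ forall f : coords -> \bar R, measurable_fun setT f ->
        (forall x, 0 <= f x)%E -> iint n f = (\int[m]_x f x)%E,
      forall a b : coords, (forall i, a i <= b i) ->
        m (box n a b) = (\prod_(i < n) (b i - a i))%:E &
      forall (v : coords) (A : set coords), (forall i, (n <= i)%N -> v i = 0) ->
        measurable A -> m (shift v @^-1` A) = m A].

(** The boxes with sides [-k, k] exhaust the space and have finite mass. Tonelli's theorem in the
    induction on [n] relies on this. *)
Lemma coord_lebesgue_sigma_finite n (m : {measure set coords -> \bar R}) :
  is_coord_lebesgue n m -> sigma_finite setT m.
Proof.
case=> _ mbox _.
exists (fun k => box n (fun=> - k%:R) (fun=> k%:R)).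
  apply/seteqP; split=> // x _.
  have [k hk] : exists k : nat, forall i, (i < n)%N -> `|x i| <= k%:R :> R.
    elim: n {mbox} => [|n [k hk]]; first by exists 0%N.
    exists (maxn k (Num.bound `|x n|)) => i; rewrite ltnS leq_eqVlt.
    case/orP => [/eqP ->|/hk h].
      apply: (le_trans (ltW (archi_boundP (normr_ge0 _)))).
      by rewrite ler_nat leq_maxr.
    by rewrite (le_trans h)// ler_nat leq_maxl.
  exists k => // i /hk; rewrite ler_norml //.
move=> k; split; first exact: measurable_box.
by rewrite mbox ?ltry// => i; rewrite (le_trans (y := 0)) // oppr_le0.
Qed.

(** [iint 0] is evaluation at the zero sequence, that is, integration against a Dirac mass. *)
Lemma coord_lebesgue0 : exists m, is_coord_lebesgue 0 m.
Proof.
exists (@dirac _ coords (fun _ => 0) R : {measure set coords -> \bar R}).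
split => [f mf f0|a b ab|v A v0 mA].
- by rewrite integral_dirac // diracT mul1e.
- by rewrite big_ord0 /= diracE mem_set.
rewrite /= !diracE; congr ((nat_of_bool _)%:R%:E).
have -> : v = (fun=> 0) by apply/funext => i; exact: v0.
congr (_ \in _); apply/seteqP; split => x /=; rewrite /shift;
   rewrite (_ : (fun _ => _) = x) //; apply/funext => i; rewrite addr0 //.
Qed.

(** The new measure is the image under [upd n] of the product of one-dimensional Lebesgue measure
    with [m]; Tonelli turns its integral into the iterated one. *)
Lemma coord_lebesgue_succ n (m : {sigma_finite_measure set coords -> \bar R}) :
  is_coord_lebesgue n m -> exists m', is_coord_lebesgue n.+1 m'.
Proof.
case=> [mint mbox mshift].
have mupd := @measurable_upd n.
pose p : {measure set _ -> \bar R} := (lebesgue_measure \x m)%E.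
have [m' m'E] : exists m' : {measure set coords -> \bar R}, 
    (m' : set coords -> \bar R) = pushforward p (upd n).
  pose q := @Measure.clone _ coords R (pushforward p (upd n)) _.
  by exists (q mupd).
have mupd1 t : measurable_fun setT (fun x => upd n (t, x)).
  apply: (measurableT_comp mupd); exact: pair1_measurable.
have m'int (f : coords -> \bar R) : measurable_fun setT f ->
   (forall x, 0 <= f x)%E ->
   (\int[m']_x f x = \int[lebesgue_measure]_t \int[m]_x f (upd n (t, x)))%E.
  move=> mf f0.
  rewrite -(@fubini_tonelli1 _ _ _ _ _ lebesgue_measure m (f \o upd n)); last first.
      by move=> x /=.
    exact: (measurableT_comp mf mupd).
  have := ge0_integral_pushforward mupd p measurableT mf (fun y _ => f0 y).
  rewrite preimage_setT => <-.
  by apply: eq_measure_integral => A _ _; rewrite m'E.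
exists m'; split.
- move=> f mf f0; rewrite m'int //=; apply: eq_integral => t _.
  rewrite -mint //; exact: (measurableT_comp mf (mupd1 t)).
- move=> a b ab; rewrite m'E /pushforward /=.
  rewrite (_ : _ @^-1` _ = `[a n, b n] `*` box n a b); last first.
    apply/seteqP; split=> -[t x] /=; rewrite /upd /=.
      move=> h; split; first by move: (h n (ltnSn n)); rewrite eqxx in_itv.
      by move=> i ni; move: (h i (ltnW ni)); rewrite (ltn_eqF ni).
    rewrite in_itv /= => -[h1 h2] i; rewrite ltnS leq_eqVlt.
    by case: eqVneq => [->|_ /= /h2].
  rewrite product_measure1E //; last exact: measurable_box.
  rewrite /= lebesgue_measure_itv /= lte_fin mbox // big_ord_recr /= mulrC.
  case: ifPn => [_|]; first by rewrite -EFinB -EFinM.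
  rewrite -leNgt => ba; have -> : a n = b n by apply/eqP; rewrite eq_le ab ba.
  by rewrite subrr mul0r mul0e.
- move=> v A v0 mA.
  have mindic B : measurable B -> m' B = (\int[m']_x (\1_B x)%:E)%E.
    by move=> mB; rewrite integral_indic // setIT.
  have mvA w B : measurable B -> measurable (shift w @^-1` B).
    by move=> mB; rewrite -[X in measurable X]setTI; exact: measurable_shift.
  rewrite !mindic //; last exact: mvA.
  have mi B : measurable B -> measurable_fun setT (fun x : coords => (\1_B x)%:E : \bar R).
    by move=> mB; apply/measurable_EFinP; exact: measurable_indic.
  rewrite !m'int //; [|by apply: mi|by apply: mi; exact: mvA].
  (* [phi t] is the mass of the slice of [A] at height [t]. Translation by [v] splits into a shift
     of [t], absorbed by the one-dimensional integral, and a shift by [w] ([v] with coordinate [n]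
     erased), absorbed by the invariance of [m]. *)
  pose phi (t : measurableTypeR R) : \bar R := (\int[m]_x (\1_A (upd n (t, x)))%:E)%E.
  have mphi : measurable_fun setT phi.
    have := @measurable_fun_fubini_tonelli_F _ _ _ _ _ m (fun z => (\1_A (upd n z))%:E).
    apply => //. exact: (measurableT_comp (mi _ mA) mupd).
  have phi0 t : (0 <= phi t)%E by apply: integral_ge0 => x _; rewrite lee_fin.
  rewrite -(ge0_integral_lebesgue_shift (v n) mphi phi0).
  apply: eq_integral => t _; rewrite /phi.
  pose w : coords := fun i => if i == n then 0 else v i.
  have mu1 c : measurable ((fun x => upd n (c, x)) @^-1` A).
    by rewrite -[X in measurable X]setTI; exact: mupd1.
  transitivity (m (shift w @^-1` ((fun x => upd n (t + v n, x)) @^-1` A))).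
    rewrite -[in RHS](setIT (shift w @^-1` _)) -integral_indic //; last exact: mvA.
    apply: eq_integral => x _; congr (_%:E).
    rewrite !indicE; congr ((nat_of_bool _)%:R); congr (_ \in A).
    apply/funext => i; rewrite /shift /upd /w /=; case: eqP => [->//|//].
  rewrite mshift //; last first.
    move=> i; rewrite /w; case: eqVneq => // ni; rewrite leq_eqVlt eq_sym (negbTE ni) /=.
    exact: v0.
  by rewrite -[in LHS](setIT (_ @^-1` _)) -integral_indic.
Qed.

Lemma coord_lebesgue n : exists m, is_coord_lebesgue n m.
Proof.
elim: n => [|n [m hm]]; first exact: coord_lebesgue0.
have sfm := coord_lebesgue_sigma_finite hm.
pose s : {sigma_finite_measure set coords -> \bar R} :=
  HB.pack (Measure.sort m)
    (@isSFinite.Build _ coords R m (sfinite_measure_sigma_finite sfm))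
    (@isSigmaFinite.Build _ coords R m sfm).
exact: (@coord_lebesgue_succ n s).
Qed.
End coordinates.

(** * Borel sets and Lebesgue measure on row vectors *)

Section borel_rV.
Variables (R : realType) (n : nat).

Definition borel_rV := g_sigma_algebraType (@open 'rV[R]_n).
HB.instance Definition _ := Measurable.on borel_rV.

Lemma closed_measurable_rV (A : set 'rV[R]_n) : closed A -> measurable (A : set borel_rV).
Proof.
move=> cA; rewrite -(setCK A); apply: measurableC; apply: sub_sigma_algebra.
exact: closed_openC.
Qed.

Lemma open_measurable_rV (A : set 'rV[R]_n) : open A -> measurable (A : set borel_rV).
Proof. by move=> oA; exact: sub_sigma_algebra. Qed.

Lemma continuous_measurable_rV (f : 'rV[R]_n -> R) : continuous f ->
  measurable_fun setT (f : borel_rV -> measurableTypeR R).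
Proof.
move=> cf; apply: (measurability _ (RGenOpens.measurableE R)) => _ [_ [a [b ->]] <-].
rewrite setTI; apply: open_measurable_rV; apply: open_comp => //; exact: interval_open.
Qed.

Definition row_of (x : coords R) : borel_rV := \row_(i < n) x (nat_of_ord i).

(** The cubes with rational centre and radius 1/(k+1) form a countable base. Preimages of open sets
    under [row_of] thereby become countable unions of cylinder conditions. *)
Lemma open_rat_ballE (U : set 'rV[R]_n) : open U ->
  U = \bigcup_(p in [set p : 'rV[rat]_n * nat |
        [set x : 'rV[R]_n | forall i, `|x ord0 i - ratr (p.1 ord0 i)| < p.2.+1%:R^-1] `<=` U])
      [set x : 'rV[R]_n | forall i, `|x ord0 i - ratr (p.1 ord0 i)| < p.2.+1%:R^-1].
Proof.
move=> oU; apply/seteqP; split=> [x Ux|x [p /= pU xp]]; last exact: pU.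
have /nbhs_ballP[e /= e0 xeU] : nbhs x U by exact: open_nbhs_nbhs.
(* Half of [e] for the distance from [x] to the rational centre, half for the distance from the
   centre to [y]. *)
have [k hk] : exists k : nat, k.+1%:R^-1 < e / 2.
  have e20 : 0 < e / 2 by rewrite divr_gt0.
  by have [k] := ltr_add_invr e20; rewrite add0r; exists k.
have k0 : 0 < k.+1%:R^-1 :> R by rewrite invr_gt0.
move: k0 hk; set r : R := k.+1%:R^-1 => k0 hk.
have hq i : exists q : rat, `|x ord0 i - ratr q| < r.
  have [q hq] : exists q : rat, ratr q \in `]x ord0 i - r, x ord0 i + r[.
    by apply: rat_in_itvoo; lra.
  by exists q; move: hq; rewrite in_itv /= ltr_distl => /andP[h1 h2]; apply/andP; split; lra.
have [q qP] := choice hq.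
exists (\row_i q i, k) => /= [y yq|i]; last by rewrite mxE.
apply: xeU; split=> // i j; rewrite ord1 -ball_normE /=.
have := yq j; have := qP j; rewrite !mxE /ball_/= => h1 h2.
have -> : x ord0 j - y ord0 j = (x ord0 j - ratr (q j)) - (y ord0 j - ratr (q j)) by ring.
move: h2; rewrite -/r => h2; apply: (le_lt_trans (ler_normB _ _)); lra.
Qed.

Lemma measurable_row_of : measurable_fun setT row_of.
Proof.
apply: (@measurability _ _ _ _ setT row_of (@open 'rV[R]_n)) => //.
move=> _ [U oU <-]; rewrite setTI (open_rat_ballE oU) preimage_bigcup.
rewrite bigcup_mkcond; apply: countable_bigcupT_measurable => [|p].
  exact: countableP.
case: ifP => _ //.
rewrite (_ : _ @^-1` _ = \bigcap_(i in `I_n) [set x : coords R | forall j : 'I_n, j = i :> nat ->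
    `|x i - ratr (p.1 ord0 j)| < p.2.+1%:R^-1]); last first.
  apply/seteqP; split=> x /=.
    by move=> h i ni j ji; have := h j; rewrite mxE ji.
  by move=> h i; rewrite mxE; apply: h => /=.
apply: bigcap_measurableType => i /= ni.
pose j := Ordinal ni.
rewrite (_ : [set _ | _] = (fun x : coords R => x i) @^-1`
    `]ratr (p.1 ord0 j) - p.2.+1%:R^-1, ratr (p.1 ord0 j) + p.2.+1%:R^-1[); last first.
  apply/seteqP; split=> x /=; rewrite in_itv /= -ltr_distl; first exact.
  move=> h k kj; have -> // : k = j by apply: val_inj.
rewrite -[X in measurable X]setTI; exact: (@measurable_coord R i).
Qed.

Definition is_rV_lebesgue (nu : {measure set borel_rV -> \bar R}) :=
  [/\ forall f : borel_rV -> \bar R, measurable_fun setT f ->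
        (forall x, 0 <= f x)%E -> lebesgue_int f = (\int[nu]_x f x)%E,
      forall a b : 'rV[R]_n, (forall i, a ord0 i <= b ord0 i) ->
        nu [set x : 'rV[R]_n | forall i, a ord0 i <= x ord0 i <= b ord0 i] =
          (\prod_(i < n) (b ord0 i - a ord0 i))%:E &
      forall (v : 'rV[R]_n) (A : set (borel_rV)), measurable A ->
        nu ((fun x : 'rV[R]_n => x + v) @^-1` A) = nu A].

Lemma lebesgue_rV : exists nu, is_rV_lebesgue nu.
Proof.
have [m [mint mbox mshift]] := coord_lebesgue R n.
pose q := @Measure.clone _ borel_rV R (pushforward m row_of) _.
have mr := measurable_row_of.
(* Padding by 0 beyond [n] is what the translation clause of [is_coord_lebesgue] asks for. *)
pose ext (v : 'rV[R]_n) : coords R := fun i => oapp (v ord0) 0 (insub i).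
have extE v (i : 'I_n) : ext v i = v ord0 i by rewrite /ext valK.
exists (q mr); split.
- move=> f mf f0; rewrite /lebesgue_int.
  rewrite (mint (fun x => f (row_of x))) //; last exact: (measurableT_comp mf mr).
  rewrite (ge0_integral_pushforward mr) //.
- move=> a b ab; rewrite /= /pushforward.
  rewrite (_ : _ @^-1` _ = box n (ext a) (ext b)); last first.
    apply/seteqP; split=> x /= h i; last first.
      by rewrite mxE -!extE; apply: h.
    by move=> ni; have := h (Ordinal ni); rewrite mxE -!extE.
  rewrite mbox; last first.
    by move=> i; rewrite /ext; case: insubP => //= j _ _.
  by congr (_%:E); apply: eq_bigr => i _; rewrite !extE.
- move=> v A mA; rewrite /= /pushforward -[RHS](mshift (ext v)).
  + congr (m _); apply/seteqP; split=> x /=; congr A;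
      apply/rowP => i; rewrite !mxE /shift extE //.
  + by move=> i ni; rewrite /ext insubF // ltnNge ni.
  + by rewrite -[X in measurable X]setTI; exact: mr.
Qed.
End borel_rV.

(** * Cones and self-dual sectors *)

Section dotp.
Variables (R : realType) (n : nat).
Implicit Types x y z : 'rV[R]_n.

Lemma dotpC x y : dotp x y = dotp y x.
Proof. by apply: eq_bigr => i _; rewrite mulrC. Qed.

Lemma dotpDl x y z : dotp (x + y) z = dotp x z + dotp y z.
Proof. by rewrite -big_split; apply: eq_bigr => i _; rewrite mxE mulrDl. Qed.

Lemma dotpZl a x y : dotp (a *: x) y = a * dotp x y.
Proof. by rewrite mulr_sumr; apply: eq_bigr => i _; rewrite mxE mulrA. Qed.

Lemma dotpDr x y z : dotp z (x + y) = dotp z x + dotp z y.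
Proof. by rewrite dotpC dotpDl !(dotpC z). Qed.

Lemma dotpZr a x y : dotp y (a *: x) = a * dotp y x.
Proof. by rewrite dotpC dotpZl (dotpC y). Qed.

Lemma dotpNl x y : dotp (- x) y = - dotp x y.
Proof. by rewrite -scaleN1r dotpZl mulN1r. Qed.

Lemma dotpNr x y : dotp y (- x) = - dotp y x.
Proof. by rewrite dotpC dotpNl (dotpC y). Qed.

End dotp.

Local Notation dotpE := (dotpDl, dotpDr, dotpNl, dotpNr, dotpZl, dotpZr).

(** * Euclidean norm, continuity and compactness *)

Section norm.
Variables (R : realType) (n : nat).
Implicit Types x y z : 'rV[R]_n.

Lemma dotp0l x : dotp 0 x = 0.
Proof. by rewrite -(scale0r 0) dotpZl mul0r. Qed.

Lemma dotp0r x : dotp x 0 = 0.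
Proof. by rewrite dotpC dotp0l. Qed.

Lemma dotp_ge0 x : 0 <= dotp x x.
Proof. by apply: sumr_ge0 => i _; exact: sqr_ge0. Qed.

Lemma dotp_eq0 x : (dotp x x == 0) = (x == 0).
Proof.
apply/eqP/eqP => [h|->]; last exact: dotp0l.
apply/rowP => i; rewrite mxE.
have /eqP := psumr_eq0P (P := predT) (fun i _ => sqr_ge0 (x ord0 i)) h (i:=i) isT.
by rewrite mulf_eq0 orbb => /eqP.
Qed.

Lemma enorm_ge0 x : 0 <= enorm x.
Proof. exact: sqrtr_ge0. Qed.

Lemma enorm_sqr x : enorm x ^+ 2 = dotp x x.
Proof. by rewrite sqr_sqrtr ?dotp_ge0. Qed.

Lemma enorm_eq0 x : (enorm x == 0) = (x == 0).
Proof. by rewrite -sqrf_eq0 enorm_sqr dotp_eq0. Qed.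

Lemma enorm_gt0 x : (0 < enorm x) = (x != 0).
Proof. by rewrite lt0r enorm_ge0 andbT enorm_eq0. Qed.

Lemma enorm_dotp x : sphere x -> dotp x x = 1.
Proof. by rewrite -enorm_sqr => ->; rewrite expr1n. Qed.

Lemma sphere_dotp x : dotp x x = 1 -> sphere x.
Proof. by rewrite /sphere /enorm /= => ->; rewrite sqrtr1. Qed.

Lemma enormZ a x : enorm (a *: x) = `|a| * enorm x.
Proof. by rewrite /enorm !dotpE mulrA sqrtrM ?sqr_ge0 // -expr2 sqrtr_sqr. Qed.

Lemma cauchy_schwarz x y : `|dotp x y| <= enorm x * enorm y.
Proof.
have [->|y0] := eqVneq y 0.
  by rewrite dotp0r normr0 mulr_ge0 ?enorm_ge0.
rewrite -(@ler_pXn2r _ 2) ?nnegrE ?mulr_ge0 ?enorm_ge0 //.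
rewrite exprMn !enorm_sqr real_normK ?num_real //.
have yy : 0 < dotp y y by rewrite lt0r dotp_eq0 y0 dotp_ge0.
(* This vector is <y,y> times the component of [x] orthogonal to [y]; its squared norm is <y,y>
   (<x,x> <y,y> - <x,y>^2). *)
have := dotp_ge0 (dotp y y *: x - dotp x y *: y).
rewrite !dotpE (dotpC y x) => h.
rewrite -(ler_pM2l yy) -subr_ge0; move: h; congr (_ <= _); ring.
Qed.

Lemma enormD x y : enorm (x + y) <= enorm x + enorm y.
Proof.
rewrite -(@ler_pXn2r _ 2) ?nnegrE ?addr_ge0 ?enorm_ge0 //.
rewrite sqrrD !enorm_sqr !dotpE (dotpC y x).
have := le_trans (ler_norm _) (cauchy_schwarz x y).
lra.
Qed.

Lemma coord_le_enorm x i : `|x ord0 i| <= enorm x.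
Proof.
rewrite -sqrtr_sqr ler_sqrt ?dotp_ge0 // /dotp (bigD1 i) //= expr2 lerDl.
by apply: sumr_ge0 => j _; exact: sqr_ge0.
Qed.

Lemma sphere_normalize x : x != 0 -> sphere ((enorm x)^-1 *: x).
Proof.
move=> x0; rewrite /sphere /= enormZ gtr0_norm ?invr_gt0 ?enorm_gt0 //.
by rewrite mulVf // enorm_eq0.
Qed.

Lemma dotp_cvg T (F : set_system T) {FF : Filter F} (f g : T -> 'rV[R]_n) a b :
  f @ F --> a -> g @ F --> b -> (fun t => dotp (f t) (g t)) @ F --> dotp a b.
Proof.
move=> fa gb; rewrite /dotp.
have addc : continuous (fun p : R * R => p.1 + p.2).
  by move=> p; apply: cvgD; [exact: cvg_fst|exact: cvg_snd].
apply: (@cvg_big R _ +%R 0 xpredT addc T F (index_enum _)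
  (fun i t => f t ord0 i * g t ord0 i) (fun i => a ord0 i * b ord0 i) FF) => i _.
apply: cvgM.
  exact: (cvg_comp _ _ fa (@coord_continuous R 1 n ord0 i a)).
exact: (cvg_comp _ _ gb (@coord_continuous R 1 n ord0 i b)).
Qed.

Lemma dotp_continuous y : continuous (fun x => dotp x y).
Proof.
move=> x; apply: (@dotp_cvg _ (nbhs x) _ id (fun=> y) x y); first exact: cvg_id.
exact: cvg_cst.
Qed.

Lemma enorm_cvg T (F : set_system T) {FF : Filter F} (f : T -> 'rV[R]_n) a :
  f @ F --> a -> (fun t => enorm (f t)) @ F --> enorm a.
Proof.
move=> fa; apply: (cvg_comp (fun t => dotp (f t) (f t)) _ (dotp_cvg fa fa)).
exact: sqrt_continuous.
Qed.

Lemma enorm_continuous : continuous (@enorm R n).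
Proof. by move=> x; apply: (@enorm_cvg _ (nbhs x) _ id x); exact: cvg_id. Qed.

Lemma closed_enorm_le (M : R) : closed [set x : 'rV[R]_n | enorm x <= M].
Proof.
apply: (@closed_comp _ _ (@enorm R n) [set r | r <= M]); last exact: closed_le.
by move=> x _; exact: enorm_continuous.
Qed.

Lemma compact_enorm_le (M : R) : compact [set x : 'rV[R]_n | enorm x <= M].
Proof.
apply: bounded_closed_compact; last exact: closed_enorm_le.
exists M; split; first exact: num_real.
move=> K MK x /= xM.
rewrite /Num.norm /= mx_normrE; apply/bigmax_leP; split.
  by rewrite (le_trans (enorm_ge0 x)) // (le_trans xM) // ltW.
move=> [i j] _ /=; rewrite ord1 (le_trans (coord_le_enorm _ _)) //.
by rewrite (le_trans xM) // ltW.
Qed.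

(** The image of an ultrafilter is an ultrafilter, and one that contains a compact ball converges.
    This replaces all extraction of subsequences. *)
Lemma ultra_cvg_bounded (U : set_system nat) (M : R) (x : nat -> 'rV[R]_n) :
  UltraFilter U -> (forall k, enorm (x k) <= M) -> exists a : 'rV[R]_n, x @ U --> a.
Proof.
move=> UU xM; have := @compact_enorm_le M; rewrite compact_ultra => /(_ (fmap x U)).
case.
- split; first exact: fmap_proper_filter.
  move=> G PG xG; apply/seteqP; split=> // A GA; rewrite /fmap /=.
  have [//|UnA] := in_ultra_setVsetC (x @^-1` A) UU.
  have GnA : G (~` A) by exact: xG.
  have FG : Filter G by case: PG.
  by have := @filterI _ G FG A (~` A) GA GnA; rewrite setICr; case: PG.
- apply: (@filterS _ U _ setT) => [k _|]; [exact: xM|exact: filterT].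
- by move=> a [_ ?]; exists a.
Qed.

End norm.

(** * Dual cones, projection onto a cone, self-dual extension *)

Section cones.
Variables (R : realType) (n : nat).
Implicit Types (x y z : 'rV[R]_n) (S N : set 'rV[R]_n).

(** The dual cone, without the normalization built into [dual]. For self-dual [S] it is the cone
    over [S] together with 0. *)
Definition dcone S : set 'rV[R]_n := [set x | forall z, S z -> 0 <= dotp x z].

Lemma dualE S : dual S = dcone S `&` @sphere R n.
Proof. by apply/seteqP; split=> x [? ?]; split. Qed.

Lemma closed_dotp_ge z (c : R) : closed [set x | c <= dotp x z].
Proof.
apply: (@preimage_closed _ _ (fun x => dotp x z) [set r | c <= r]); last exact: closed_ge.
by move=> x _; exact: dotp_continuous.
Qed.

Lemma closed_dcone S : closed (dcone S).
Proof.
rewrite (_ : dcone S = \bigcap_(z in S) [set x | 0 <= dotp x z]) //.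
by apply: closed_bigI => z _; exact: closed_dotp_ge.
Qed.

Lemma is_cone_dcone S : is_cone (dcone S).
Proof. by move=> x t hx t0 z /hx xz; rewrite dotpZl mulr_ge0. Qed.

Lemma is_convex_dcone S : is_convex (dcone S).
Proof.
move=> x y t hx hy /andP[t0 t1] z Sz; rewrite !dotpE addr_ge0 // mulr_ge0 ?hx ?hy //.
by rewrite subr_ge0.
Qed.

Lemma is_sector_dual S : is_sector (dual S).
Proof.
by exists (dcone S); split;
  [exact: closed_dcone|exact: is_convex_dcone|exact: is_cone_dcone|exact: dualE].
Qed.

Lemma cone_add N x y : is_convex N -> is_cone N -> N x -> N y -> N (x + y).
Proof.
move=> cvxN coneN Nx Ny.
have -> : x + y = 2 *: (2^-1 *: x + (1 - 2^-1) *: y).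
  rewrite scalerDr !scalerA mulfV ?pnatr_eq0 // scale1r; congr (_ + _).
  by rewrite (_ : 2 * (1 - 2^-1) = 1 :> R) ?scale1r //; lra.
by apply: coneN => //; apply: cvxN => //; apply/andP; split; lra.
Qed.

Lemma dotp_addZ x y t : dotp (x + t *: y) (x + t *: y) =
  dotp x x + t * (2 * dotp x y + t * dotp y y).
Proof. by rewrite !dotpE (dotpC y x); ring. Qed.

(** [p] is the point of [N] nearest to [y]; the two conditions on [p - y] are the first-order
    conditions of this minimization. *)
Lemma cone_projection N y : closed N -> is_convex N -> is_cone N -> N 0 ->
  exists p, [/\ N p, forall z, N z -> 0 <= dotp (p - y) z & dotp (p - y) p = 0].
Proof.
move=> clN cvxN coneN N0.
(* A point of norm above 2|y| is farther from [y] than 0 is, so the minimum over the compact part of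
   [N] of radius [M] is global. *)
pose M := 2 * enorm y.
pose f x := dotp (x - y) (x - y).
have fc : continuous f.
  move=> x; apply: (@dotp_cvg R n _ (nbhs x) _ (fun x => x - y) (fun x => x - y));
    apply: cvgB; [exact: cvg_id|exact: cvg_cst|exact: cvg_id|exact: cvg_cst].
have cK : compact (N `&` [set x : 'rV[R]_n | enorm x <= M]).
  rewrite setIC; apply: compact_closedI => //; exact: compact_enorm_le.
have K0 : (N `&` [set x : 'rV[R]_n | enorm x <= M]) !=set0.
  exists 0; split=> //=; rewrite /enorm dotp0l sqrtr0 /M.
  by rewrite mulr_ge0 // enorm_ge0.
have [p pK pmin] := compact_EVT_min K0 cK (continuous_subspaceT fc).
rewrite inE in pK; case: pK => Np pM.
have {}pmin z : N z -> f p <= f z.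
  move=> Nz; have [zM|zM] := leP (enorm z) M.
    by apply: pmin; rewrite inE.
  have fz : f 0 <= f z.
    rewrite /f sub0r -!enorm_sqr ler_pXn2r ?nnegrE ?enorm_ge0 //.
    have -> : enorm (- y) = enorm y by rewrite -scaleN1r enormZ normrN1 mul1r.
    have := enormD (z - y) y; rewrite subrK; rewrite /M in zM; lra.
  apply: le_trans fz; apply: pmin; rewrite inE; split=> //=.
  by rewrite /enorm dotp0l sqrtr0 /M mulr_ge0 // enorm_ge0.
(* First variation at [p]. Restricting [t] to [0, 1] makes the direction [- p] admissible as well,
   which gives the orthogonality. *)
have key z : (forall t, 0 <= t <= 1 -> N (p + t *: z)) -> 0 <= dotp (p - y) z.
  move=> Nt; rewrite leNgt; apply/negP => neg.
  pose d := dotp (p - y) z; pose c := dotp z z.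
  have c0 : 0 <= c by exact: dotp_ge0.
  have d0 : d < 0 by [].
  (* With this [t] one has 2d + tc = d(1 + t) < 0, so [f] would decrease from [p] to
     [p + t *: z]. *)
  pose t := - d / (c - d).
  have cd : 0 < c - d by lra.
  have t0 : 0 < t by rewrite divr_gt0 // oppr_gt0.
  have t1 : t <= 1 by rewrite ler_pdivrMr //; lra.
  have := pmin _ (Nt t _); rewrite (ltW t0) t1 => /(_ isT).
  rewrite /f addrAC dotp_addZ -/d -/c lerDl.
  rewrite pmulr_rge0 //.
  have tc : t * (c - d) = - d by rewrite /t divfK // gt_eqF.
  have : t * d < 0 by rewrite pmulr_rlt0.
  lra.
exists p; split=> //.
  move=> z Nz; apply: key => t /andP[t0 _]; apply: cone_add => //; exact: coneN.
apply/eqP; rewrite eq_le; apply/andP; split.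
  rewrite -oppr_ge0 -dotpNr; apply: key => t /andP[t0 t1].
  have -> : p + t *: - p = (1 - t) *: p by rewrite scalerBl scale1r scalerN.
  by apply: coneN => //; rewrite subr_ge0.
by apply: key => t /andP[t0 _]; apply: cone_add => //; exact: coneN.
Qed.

(** Separation: if [y] differs from its projection [p], the normalized [p - y] lies in [dual S], yet
    <y, p - y> = -|p - y|^2 < 0. *)
Lemma bidual_sub S : is_sector S -> dual (dual S) `<=` S.
Proof.
move=> [N [clN cvxN coneN SN]] y [sy hy].
(* The dual of the empty sector is the whole sphere; it contains [- y], which excludes [y] from the
   bidual. *)
have [[x Sx]|S0] := pselect (exists x, S x); last first.
  have : dual S (- y).
    split; last by move=> x Sx; exfalso; apply: S0; exists x.
    by apply: sphere_dotp; rewrite !dotpE opprK enorm_dotp.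
  by move/hy; rewrite dotpNr enorm_dotp // oppr_ge0 ler10.
have N0 : N 0 by rewrite -(scale0r x); apply: coneN => //; move: Sx; rewrite SN => -[].
have [p [Np hp pp]] := cone_projection y clN cvxN coneN N0.
have [q0|q0] := eqVneq (p - y) 0.
  by rewrite SN; split=> //; move/eqP: q0; rewrite subr_eq0 => /eqP <-.
have nq : 0 < enorm (p - y) by rewrite enorm_gt0.
have : dual S ((enorm (p - y))^-1 *: (p - y)).
  split; first exact: sphere_normalize.
  move=> z; rewrite SN => -[Nz _]; rewrite dotpZl mulr_ge0 ?invr_ge0 ?hp //.
  exact: ltW.
move/hy; rewrite dotpZr pmulr_rge0 ?invr_gt0 // => h.
have : dotp (p - y) (p - y) = - dotp y (p - y).
  by rewrite [LHS]dotpDr pp add0r dotpNr (dotpC y).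
have : 0 < dotp (p - y) (p - y) by rewrite -enorm_sqr exprn_gt0.
lra.
Qed.

(** Zorn's lemma: a unit vector of the dual of a maximal [A] can be adjoined to [A], hence already
    belongs to it. *)
Lemma self_dual_extension (A0 : set 'rV[R]_n) : A0 `<=` @sphere R n ->
  (forall x y, A0 x -> A0 y -> 0 <= dotp x y) ->
  exists2 A, A0 `<=` A & dual A = A.
Proof.
move=> sA0 pA0.
(* Stating the property for the union with [A0] makes the empty chain admissible and forces a
   maximal set to contain [A0]. *)
pose P (A : set 'rV[R]_n) := (A `|` A0 `<=` @sphere R n) /\
  forall x y, (A `|` A0) x -> (A `|` A0) y -> 0 <= dotp x y.
have chain (F : set (set 'rV[R]_n)) : F `<=` P -> total_on F subset ->
    P (\bigcup_(X in F) X).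
  move=> FP totF; split=> [x|x y].
    by case=> [[X FX Xx]|/sA0//]; apply: (FP _ FX).1; left.
  case=> [[X FX Xx]|A0x]; case=> [[Y FY Yy]|A0y]; last exact: pA0.
  - have [XY|YX] := totF _ _ FX FY.
      by apply: (FP _ FY).2; left => //; exact: XY.
    by apply: (FP _ FX).2; left => //; exact: YX.
  - by apply: (FP _ FX).2; [left|right].
  - by apply: (FP _ FY).2; [right|left].
have [A [[sA pA] Amax]] := Zorn_bigcup chain.
have max B : A `<=` B -> P B -> B `<=` A.
  move=> AB PB; apply: contrapT => BA; exact: (Amax B).
have A0A : A0 `<=` A.
  apply: subset_trans (max (A `|` A0) _ _) => //.
  by rewrite /P -setUA setUid.
exists A => //.
rewrite (setUidl A0A) in sA pA.
apply/seteqP; split=> [y [sy hy]|y Ay]; last first.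
  by split; [exact: sA|move=> x Ax; exact: pA].
apply: (max (A `|` [set y])) => //; last by right.
have -> : P (A `|` [set y]) = ((A `|` [set y] `<=` @sphere R n) /\
    forall u v, (A `|` [set y]) u -> (A `|` [set y]) v -> 0 <= dotp u v).
  by rewrite /P -setUA (setUC _ A0) setUA (setUidl A0A).
split=> [u [/sA//|->//]|u v].
case=> [Au|->]; case=> [Av|->].
- exact: pA.
- by rewrite dotpC; exact: hy.
- exact: hy.
- exact: dotp_ge0.
Qed.

(** * Moreau decomposition in a self-dual cone *)

Section self_dual.
Variable S : set 'rV[R]_n.
Hypothesis Sd : dual S = S.

Lemma self_dual_sphere x : S x -> sphere x.
Proof. by rewrite -Sd => -[]. Qed.

Lemma self_dual_dcone x : S x -> dcone S x.
Proof. by rewrite -{1}Sd => -[]. Qed.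

Lemma self_dual_normalize x : dcone S x -> x != 0 -> S ((enorm x)^-1 *: x).
Proof.
move=> Sx x0; rewrite -Sd; split; first exact: sphere_normalize.
by apply: is_cone_dcone => //; rewrite invr_ge0 enorm_ge0.
Qed.

Lemma self_dual_pos x y : dcone S x -> dcone S y -> 0 <= dotp x y.
Proof.
move=> hx hy; have [->|y0] := eqVneq y 0; first by rewrite dotp0r.
have := hx _ (self_dual_normalize hy y0).
by rewrite dotpZr pmulr_rge0 // invr_gt0 enorm_gt0.
Qed.

Lemma self_dual_classC : classC S.
Proof. by split; rewrite ?Sd// -Sd; exact: is_sector_dual. Qed.

(** Project [y] onto [dcone S]: the residual [p - y] is nonnegative against that cone, hence lies in
    it by self-duality. *)
Lemma self_dual_moreau y : exists p q,
  [/\ dcone S p, dcone S q, y = p - q & dotp p q = 0].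
Proof.
have S0 : dcone S 0 by move=> z _; rewrite dotp0l.
have [p [Np hp pp]] := cone_projection y (@closed_dcone S) (@is_convex_dcone S)
  (@is_cone_dcone S) S0.
exists p, (p - y); split=> //.
- by move=> z Sz; apply: hp; exact: self_dual_dcone.
- by rewrite opprB addrC subrK.
- by rewrite dotpC.
Qed.

(** Decompose each basis vector as p_i - q_i and let s be the sum of all p_i + q_i. For z in S, <p_i
    + q_i, z> >= |z_i| >= z_i^2, and these squares add up to 1. *)
Lemma self_dual_interior : exists2 s, dcone S s & forall z, S z -> 1 <= dotp s z.
Proof.
have /choice[p /choice[q pq]] i := self_dual_moreau (delta_mx ord0 i).
have dotp_sum z : dotp (\sum_i (p i + q i)) z = \sum_i dotp (p i + q i) z.
  by elim/big_rec2 : _ => [|i a b _ <-]; rewrite ?dotp0l ?dotpDl.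
have bd z : S z -> 1 <= dotp (\sum_i (p i + q i)) z.
  move=> Sz; rewrite dotp_sum -(enorm_dotp (self_dual_sphere Sz)).
  apply: ler_sum => i _.
  have [dp dq e _] := pq i.
  have ze : dotp (p i) z - dotp (q i) z = z ord0 i.
    rewrite -dotpNl -dotpDl -e /dotp (bigD1 i) //= big1 => [|j ji].
      by rewrite mxE !eqxx mul1r addr0.
    by rewrite mxE eqxx (negbTE ji) mul0r.
  have z1 : `|z ord0 i| <= 1.
    by have := coord_le_enorm z i; rewrite (self_dual_sphere Sz).
  rewrite dotpDl; have := dp z Sz; have := dq z Sz.
  move: z1; rewrite ler_norml => /andP[]; rewrite -!ze.
  set a := dotp (p i) z; set b := dotp (q i) z; nra.
exists (\sum_i (p i + q i)) => // z Sz.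
exact: le_trans (bd z Sz).
Qed.

End self_dual.

(** * Ultralimits of self-dual sectors *)

Section ultralimit.
Variables (S_ : nat -> set 'rV[R]_n) (U : set_system nat).
Hypothesis Sd : forall k, dual (S_ k) = S_ k.
Context {UU : UltraFilter U}.

(** The approximating points are taken in the cones, so components of Moreau decompositions can
    serve without being normalized. *)
Definition ultralim : set 'rV[R]_n := [set x | sphere x /\
  exists z : nat -> 'rV[R]_n, (forall k, dcone (S_ k) (z k)) /\ z @ U --> x].

(** Nonnegativity of products passes to the limit, which gives one inclusion. Conversely write y =
    p_k - q_k in each cone, with orthogonal limits p0 and q0: a nonzero q0 would normalize to a
    point of the limit set, although <y, q0> = -|q0|^2 < 0. So y = p0. *)
Lemma ultralim_self_dual : dual ultralim = ultralim.
Proof.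
apply/seteqP; split=> y; last first.
  move=> [sy [z [zS zy]]]; split=> // x [sx [w [wS wx]]].
  apply: (cvgr_to_ge (dotp_cvg zy wx)); apply: nearW => k.
  exact: (self_dual_pos (Sd k)).
move=> [sy hy].
have /choice[p /choice[q pq]] k := self_dual_moreau (Sd k) y.
have nrm k : dotp (p k) (p k) + dotp (q k) (q k) = 1.
  have [_ _ e o] := pq k.
  by rewrite -(enorm_dotp sy) e !dotpE (dotpC (q k)) o; ring.
have [p0 pp0] : exists p0 : 'rV[R]_n, p @ U --> p0.
  apply: (@ultra_cvg_bounded R n U 1 p) => k.
  rewrite -(@ler_pXn2r _ 2) ?nnegrE ?enorm_ge0 // enorm_sqr expr1n -(nrm k).
  by rewrite lerDl dotp_ge0.
have [q0 qq0] : exists q0 : 'rV[R]_n, q @ U --> q0.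
  apply: (@ultra_cvg_bounded R n U 1 q) => k.
  rewrite -(@ler_pXn2r _ 2) ?nnegrE ?enorm_ge0 // enorm_sqr expr1n -(nrm k).
  by rewrite lerDr dotp_ge0.
have e : y = p0 - q0.
  have h : (fun k => p k - q k) @ U --> p0 - q0 by exact: cvgB.
  have h' : (fun k => p k - q k) @ U --> y.
    rewrite (_ : (fun _ => _) = fun=> y); first exact: cvg_cst.
    by apply/funext => k; have [_ _ <-] := pq k.
  exact: (cvg_unique _ h' h).
have o : dotp p0 q0 = 0.
  have h : (fun k => dotp (p k) (q k)) @ U --> dotp p0 q0 by exact: dotp_cvg.
  have hk k : dotp (p k) (q k) = 0 by have [] := pq k.
  apply/eqP; rewrite eq_le; apply/andP; split.
    by apply: (cvgr_to_le h); apply: nearW => k; rewrite hk.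
  by apply: (cvgr_to_ge h); apply: nearW => k; rewrite hk.
have [q00|q00] := eqVneq q0 0.
  split=> //; exists p; split; first by move=> k; have [] := pq k.
  by rewrite e q00 subr0.
have nq : 0 < (enorm q0)^-1 by rewrite invr_gt0 enorm_gt0.
have : ultralim ((enorm q0)^-1 *: q0).
  split; first exact: sphere_normalize.
  exists (fun k => (enorm q0)^-1 *: q k); split.
    by move=> k; apply: is_cone_dcone; [have [] := pq k|exact: ltW].
  by apply: cvgZr; exact: qq0.
move/hy; rewrite dotpZr pmulr_rge0 // e dotpDl dotpNl o add0r oppr_ge0.
by rewrite leNgt lt0r dotp_eq0 q00 dotp_ge0.
Qed.

(** For [T] on the sphere: the closed cone of vectors whose angle with each point of [T] has cosine
    at least 1/(m+1). *)
Definition shrink (T : set 'rV[R]_n) (m : nat) : set 'rV[R]_n :=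
  [set x | forall z, T z -> enorm x * m.+1%:R^-1 <= dotp x z].

(** Otherwise, for almost all k, some x_k of the shrunken set has a negative product with some z_k
    in S_k. The limit z lies in [ultralim], so <x, z> >= 1/(m+1), while the limit of the products is
    at most 0. *)
Lemma shrink_ultralim m :
  \forall k \near U, @sphere R n `&` shrink ultralim m `<=` S_ k.
Proof.
have [//|h] := in_ultra_setVsetC
  [set k | @sphere R n `&` shrink ultralim m `<=` S_ k] UU.
exfalso.
have [k0 nk0] := filter_ex h.
have wit k : exists xz : 'rV[R]_n * 'rV[R]_n,
   [/\ sphere xz.1, shrink ultralim m xz.1, sphere xz.2, dcone (S_ k) xz.2 &
     ~ (@sphere R n `&` shrink ultralim m `<=` S_ k) -> dotp xz.1 xz.2 < 0].
  have bad j : ~ (@sphere R n `&` shrink ultralim m `<=` S_ j) ->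
      exists2 x, (sphere x /\ shrink ultralim m x) & ~ S_ j x.
    move=> nj; apply: contrapT => ne; apply: nj => x xE; apply: contrapT => nx.
    by apply: ne; exists x.
  have [x0 [sx0 hx0] _] := bad _ nk0.
  (* At an index without violation a filler pair is chosen: [x0] and any point of [S_ k], which is
     nonempty because otherwise its dual would contain [x0]. *)
  have [sub|nsub] := pselect (@sphere R n `&` shrink ultralim m `<=` S_ k).
    have [z Sz] : exists z, S_ k z.
      apply: contrapT => ne; apply: (ne); exists x0.
      by rewrite -Sd; split=> // z Sz; exfalso; apply: ne; exists z.
    exists (x0, z); split=> //=; first exact: (self_dual_sphere (Sd k)).
    exact: (self_dual_dcone (Sd k)).
  have [x [sx hx] nx] := bad _ nsub.
  have [z Sz xz] : exists2 z, S_ k z & dotp x z < 0.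
    apply: contrapT => ne; apply: nx; rewrite -Sd; split=> // z Sz.
    by rewrite leNgt; apply/negP => xz; apply: ne; exists z.
  exists (x, z); split=> //=; first exact: (self_dual_sphere (Sd k)).
  exact: (self_dual_dcone (Sd k)).
have /choice[xz hxz] := wit.
have [x xx] : exists x : 'rV[R]_n, (fst \o xz) @ U --> x.
  apply: (@ultra_cvg_bounded R n U 1) => k.
  by have [s _ _ _ _] := hxz k; rewrite /= s.
have [z zz] : exists z : 'rV[R]_n, (snd \o xz) @ U --> z.
  apply: (@ultra_cvg_bounded R n U 1) => k.
  by have [_ _ s _ _] := hxz k; rewrite /= s.
have sphere_lim (f : nat -> 'rV[R]_n) a : f @ U --> a -> (forall k, sphere (f k)) -> sphere a.
  move=> fa sf; have : (fun k => enorm (f k)) @ U --> enorm a by exact: enorm_cvg.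
  move=> h1; apply/eqP; rewrite eq_le; apply/andP; split.
    by apply: (cvgr_to_le h1); apply: nearW => k; rewrite sf.
  by apply: (cvgr_to_ge h1); apply: nearW => k; rewrite sf.
have sx : sphere x by apply: (sphere_lim _ _ xx) => k; have [] := hxz k.
have sz : sphere z by apply: (sphere_lim _ _ zz) => k; have [] := hxz k.
have uz : ultralim z.
  by split=> //; exists (snd \o xz); split=> // k; have [] := hxz k.
have ge : m.+1%:R^-1 <= dotp x z.
  apply: (cvgr_to_ge (dotp_cvg xx (cvg_cst z))); apply: nearW => k.
  by have [s1 sh _ _ _] := hxz k; have := sh _ uz; rewrite s1 mul1r.
have le : dotp x z <= 0.
  apply: (cvgr_to_le (dotp_cvg xx zz)).
  apply: filterS h => k /= nk; apply: ltW.
  by have [_ _ _ _ /(_ nk)] := hxz k.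
have : 0 < m.+1%:R^-1 :> R by rewrite invr_gt0.
by rewrite ltNge (le_trans ge le).
Qed.

End ultralimit.
End cones.

(** * Integrals over sectors *)

Section cone_int.
Variables (R : realType) (n : nat) (nu : {measure set (borel_rV R n) -> \bar R}).
Implicit Types (x y z u : 'rV[R]_n) (S N : set 'rV[R]_n).

Hypothesis nuP : is_rV_lebesgue nu.

Definition pball : set 'rV[R]_n := [set x | 0 < enorm x <= 1].

Lemma measurable_pball : measurable (pball : set (borel_rV R n)).
Proof.
rewrite (_ : pball = [set x | enorm x <= 1] `\` [set x | enorm x <= 0]).
  by apply: measurableD; apply: closed_measurable_rV; exact: closed_enorm_le.
apply/seteqP; split=> x; rewrite /pball /=; first by case/andP => x0 x1; split=> //; rewrite leNgt x0.
by case=> h /negP; rewrite -ltNge => ->.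
Qed.

Lemma measurable_pball_closed N : closed N ->
  measurable (pball `&` N : set (borel_rV R n)).
Proof.
by move=> cN; apply: measurableI; [exact: measurable_pball|exact: closed_measurable_rV].
Qed.

Lemma measurable_pball_dcone S :
  measurable (pball `&` dcone S : set (borel_rV R n)).
Proof. by apply: measurable_pball_closed; exact: closed_dcone. Qed.

Lemma measurable_dotp_normalized u :
  measurable_fun setT (fun x : borel_rV R n => dotp ((enorm x)^-1 *: x) u).
Proof.
rewrite (_ : (fun _ => _) = fun x : borel_rV R n => powR (enorm x) (-1) * dotp x u).
  apply: measurable_funM.
    apply: (measurableT_comp (measurable_powR (-1))).
    by apply: continuous_measurable_rV; exact: enorm_continuous.
  by apply: continuous_measurable_rV; exact: dotp_continuous.
by apply/funext => x; rewrite dotpZl powR_inv1 // enorm_ge0.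
Qed.

(** Since [N] is a cone, x/|x| lies in the sector exactly when [x] lies in [N]. *)
Lemma sphere_intE N (f : 'rV[R]_n -> R) : closed N -> is_cone N ->
  measurable_fun setT (fun x : borel_rV R n => f ((enorm x)^-1 *: x)) ->
  (forall x, (N `&` @sphere R n) x -> 0 <= f x) ->
  sphere_int (N `&` @sphere R n) (fun x => (f x)%:E) =
  ((n%:R)%:E * \int[nu]_(x in pball `&` N) (f ((enorm x)^-1 *: x))%:E)%E.
Proof.
move=> clN coneN mf f0; congr (_ * _)%E.
have [nuint _ _] := nuP.
have inN x : pball x -> (N `&` @sphere R n) ((enorm x)^-1 *: x) <-> N x.
  move=> /andP[x0 _]; split=> [[Nx _]|Nx].
    have := coneN _ (enorm x) Nx (enorm_ge0 _).
    by rewrite scalerA mulfV ?scale1r // gt_eqF.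
  split; first by apply: coneN => //; rewrite invr_ge0 enorm_ge0.
  by apply: sphere_normalize; rewrite -enorm_gt0.
rewrite integral_mkcond -nuint.
- congr lebesgue_int; apply/funext => x; rewrite patchE.
  case: asboolP => [[px Nx]|h].
    by rewrite mem_set //; split=> //; apply/inN.
  case: ifPn => //; rewrite inE => -[px Nx].
  by exfalso; apply: h; split=> //; apply/inN.
- apply/(measurable_restrictT _ _).1; first exact: measurable_pball_closed.
  by apply: measurable_funTS; apply/measurable_EFinP.
- move=> x; rewrite patchE; case: ifPn => //; rewrite inE => -[px Nx].
  by rewrite lee_fin; apply/f0/inN.
Qed.

(** For a closed cone [N] on which [u] is nonnegative, the spherical integral of <theta, u> over the
    sector of [N], divided by [n]. *)
Definition cone_int N u : \bar R :=
  (\int[nu]_(x in pball `&` N) (dotp ((enorm x)^-1 *: x) u)%:E)%E.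

Definition nonneg_on N u := forall x, N x -> 0 <= dotp x u.

Lemma nonneg_on_normalized N u x : nonneg_on N u -> N x ->
  0 <= dotp ((enorm x)^-1 *: x) u.
Proof. by move=> h /h x0; rewrite dotpZl mulr_ge0 // invr_ge0 enorm_ge0. Qed.

Let mEFin (N : set (borel_rV R n)) u :
  measurable_fun N (fun x : borel_rV R n => (dotp ((enorm x)^-1 *: x) u)%:E).
Proof.
by apply: measurable_funTS; apply/measurable_EFinP; exact: measurable_dotp_normalized.
Qed.

Lemma cone_int_ge0 N u : nonneg_on N u -> (0 <= cone_int N u)%E.
Proof.
move=> hu; apply: integral_ge0 => x [_ Nx].
by rewrite lee_fin; exact: nonneg_on_normalized Nx.
Qed.

Lemma le_cone_int N1 N2 u : closed N1 -> closed N2 -> nonneg_on N2 u ->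
  pball `&` N1 `<=` N2 -> (cone_int N1 u <= cone_int N2 u)%E.
Proof.
move=> c1 c2 hu s12; apply: ge0_subset_integral.
- exact: measurable_pball_closed.
- exact: measurable_pball_closed.
- exact: mEFin.
- by move=> x [_ Nx]; rewrite lee_fin; exact: nonneg_on_normalized Nx.
- by move=> x [px Nx]; split=> //; exact: s12.
Qed.

Lemma cone_int_add N u w : closed N -> nonneg_on N u -> nonneg_on N w ->
  cone_int N (u + w) = (cone_int N u + cone_int N w)%E.
Proof.
move=> cN hu hw; rewrite /cone_int -ge0_integralD.
- by apply: eq_integral => x _; rewrite dotpDr EFinD.
- exact: measurable_pball_closed.
- by move=> x [_ Nx]; rewrite lee_fin; exact: nonneg_on_normalized Nx.
- exact: mEFin.
- by move=> x [_ Nx]; rewrite lee_fin; exact: nonneg_on_normalized Nx.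
- exact: mEFin.
Qed.

Lemma cone_int_scale N u c : closed N -> nonneg_on N u -> 0 <= c ->
  cone_int N (c *: u) = (c%:E * cone_int N u)%E.
Proof.
move=> cN hu c0; rewrite /cone_int -ge0_integralZl_EFin //.
- by apply: eq_integral => x _; rewrite dotpZr EFinM.
- exact: measurable_pball_closed.
- by move=> x [_ Nx]; rewrite lee_fin; exact: nonneg_on_normalized Nx.
Qed.

Lemma closed_box (a b : 'rV[R]_n) :
  closed [set x : 'rV[R]_n | forall i, a ord0 i <= x ord0 i <= b ord0 i].
Proof.
rewrite (_ : [set _ | _] = \bigcap_(i in setT) ((fun x : 'rV[R]_n => x ord0 i) @^-1`
    [set r | a ord0 i <= r] `&` (fun x : 'rV[R]_n => x ord0 i) @^-1` [set r | r <= b ord0 i])).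
  apply: closed_bigI => i _; apply: closedI; apply: preimage_closed.
  - by move=> x _; exact: coord_continuous.
  - exact: closed_ge.
  - by move=> x _; exact: coord_continuous.
  - exact: closed_le.
apply/seteqP; split=> x /= h i; first by move=> _; move/andP: (h i).
by apply/andP; exact: h.
Qed.

Lemma nu_bounded_lty (A : set (borel_rV R n)) (M : R) : measurable A ->
  (forall x, A x -> enorm x <= M) -> (nu A < +oo)%E.
Proof.
move=> mA AM; have [_ nubox _] := nuP.
have [M0|M0] := leP 0 M; last first.
  rewrite (_ : A = set0) ?measure0 ?ltry //; apply/seteqP; split=> // x /AM h.
  by have := le_lt_trans (le_trans (enorm_ge0 _) h) M0; rewrite ltxx.
apply: (@le_lt_trans _ _ (nu [set x : 'rV[R]_n | forall i,
    (const_mx (- M) : 'rV[R]_n) ord0 i <= x ord0 i <= (const_mx M : 'rV[R]_n) ord0 i])).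
  apply: le_measure; rewrite ?inE //; first by apply: closed_measurable_rV; exact: closed_box.
  move=> x /AM xM i; rewrite !mxE -ler_norml.
  exact: le_trans (coord_le_enorm _ _) xM.
rewrite nubox ?ltry // => i; rewrite !mxE.
lra.
Qed.

Lemma nu_pball_lty : (nu pball < +oo)%E.
Proof.
by apply: (@nu_bounded_lty _ 1); [exact: measurable_pball|move=> x /andP[]].
Qed.

Lemma enorm_le_sqr x (M : R) : 0 <= M -> dotp x x <= M ^+ 2 -> enorm x <= M.
Proof.
by move=> M0; rewrite -enorm_sqr ler_pXn2r // nnegrE // enorm_ge0.
Qed.

Lemma nu_ball_gt0 s (r : R) : 0 < r -> exists A : set (borel_rV R n),
  [/\ measurable A, (0 < nu A)%E & forall x, A x -> enorm (x - s) <= r].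
Proof.
move=> r0; have [_ nubox _] := nuP.
(* A cube of half-side r/(n+1) fits in the ball of radius [r], since n/(n+1)^2 <= 1. *)
pose c := r / n.+1%:R.
have c0 : 0 < c by rewrite divr_gt0.
pose a : 'rV[R]_n := s - const_mx c; pose b : 'rV[R]_n := s + const_mx c.
exists [set x : 'rV[R]_n | forall i, a ord0 i <= x ord0 i <= b ord0 i]; split.
- by apply: closed_measurable_rV; exact: closed_box.
- rewrite nubox => [|i]; last by rewrite !mxE; lra.
  by rewrite lte_fin; apply: prodr_gt0 => i _; rewrite !mxE; lra.
- move=> x hx; apply: enorm_le_sqr; first exact: ltW.
  have : dotp (x - s) (x - s) <= \sum_(i < n) c ^+ 2.
    apply: ler_sum => i _; rewrite -expr2 -[leLHS]real_normK ?num_real //.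
    rewrite ler_pXn2r ?nnegrE //; last exact: ltW.
    by rewrite !mxE ler_norml; have := hx i; rewrite !mxE; lra.
  move/le_trans; apply; rewrite sumr_const card_ord.
  rewrite -[leRHS]mulr1 -mulr_natr /c exprMn -mulrA ler_pM2l ?exprn_gt0 //.
  rewrite exprVn mulrC ler_pdivrMr ?exprn_gt0 // mul1r -natrX ler_nat.
  apply: (leq_trans (leqnSn n)); rewrite -{1}(expn1 n.+1); exact: leq_pexp2l.
Qed.

Lemma cone_int_lty N u : closed N -> nonneg_on N u -> (cone_int N u < +oo)%E.
Proof.
move=> cN hu; apply: (@le_lt_trans _ _ (\int[nu]_(x in pball `&` N) (enorm u)%:E)%E).
  apply: ge0_le_integral.
  - exact: measurable_pball_closed.
  - by move=> x [_ Nx]; rewrite lee_fin; exact: nonneg_on_normalized Nx.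
  - exact: mEFin.
  - exact: measurable_cst.
  - move=> x [/andP[x0 _] _]; rewrite lee_fin (le_trans (ler_norm _)) //.
    rewrite (le_trans (cauchy_schwarz _ _)) // sphere_normalize ?mul1r //.
    by rewrite -enorm_gt0.
rewrite integral_cst //; last exact: measurable_pball_closed.
rewrite lte_mul_pinfty ?lee_fin ?enorm_ge0 //.
apply: (@nu_bounded_lty _ 1); first exact: measurable_pball_closed.
by move=> x [/andP[]].
Qed.

Lemma cone_int_fin_num N u : closed N -> nonneg_on N u -> cone_int N u \is a fin_num.
Proof. by move=> cN hu; rewrite ge0_fin_numE ?cone_int_ge0 // cone_int_lty. Qed.

(** A set of positive measure well inside the cone; all strict positivity of integrals comes from
    it. *)
Lemma self_dual_ball S : dual S = S -> S !=set0 ->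
  exists (A : set (borel_rV R n)) (c : R),
  [/\ measurable A, (0 < nu A)%E, 0 < c & forall x, A x ->
    pball x /\ forall z, S z -> c <= dotp x z].
Proof.
move=> Sd [z0 Sz0].
have [s ds s1] := self_dual_interior Sd.
have ns : 1 <= enorm s.
  rewrite (le_trans (s1 _ Sz0)) // (le_trans (ler_norm _)) //.
  by rewrite (le_trans (cauchy_schwarz _ _)) // (self_dual_sphere Sd Sz0) mulr1.
(* The centre [c *: s] has norm 1/2 and products at least [c] with [S]. Radius c/2 <= 1/4 keeps the
   products above c/2 and the points in the unit ball. *)
pose c := (2 * enorm s)^-1.
have c0 : 0 < c by rewrite invr_gt0; lra.
have cs : c * enorm s = 2^-1.
  by rewrite /c invfM -mulrA mulVf ?mulr1 // gt_eqF //; lra.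
have c2 : c <= 2^-1 by nra.
have [A [mA A0 hA]] := @nu_ball_gt0 (c *: s) (c / 2) (divr_gt0 c0 (ltr0n _ 2)).
have key x z : A x -> S z -> c / 2 <= dotp x z.
  move=> Ax Sz; rewrite -(subrK (c *: s) x) dotpDl dotpZl.
  have := le_trans (cauchy_schwarz (x - c *: s) z).
  rewrite (self_dual_sphere Sd Sz) mulr1 => /(_ _ (hA _ Ax)).
  rewrite ler_norml => /andP[h _].
  have : c * 1 <= c * dotp s z by rewrite ler_pM2l // s1.
  lra.
exists A, (c / 2); split=> //; first by rewrite divr_gt0.
move=> x Ax; split; last by move=> z; exact: key.
apply/andP; split.
  rewrite enorm_gt0; apply/eqP => x0.
  by have := key _ _ Ax Sz0; rewrite x0 dotp0l; lra.
rewrite -(subrK (c *: s) x) (le_trans (enormD _ _)) // enormZ gtr0_norm // cs.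
have := hA _ Ax; lra.
Qed.

Lemma nu_pball_gt0 S : dual S = S -> S !=set0 -> (0 < nu pball)%E.
Proof.
move=> Sd S0; have [A [c [mA A0 c0 hA]]] := self_dual_ball Sd S0.
apply: (lt_le_trans A0); apply: le_measure; rewrite ?inE //.
  exact: measurable_pball.
by move=> x /hA[].
Qed.

Lemma self_dual_nonneg_on S u : S u -> nonneg_on (dcone S) u.
Proof. by move=> Su x; exact. Qed.

Lemma cone_int_gt0 S u : dual S = S -> S u -> (0 < cone_int (dcone S) u)%E.
Proof.
move=> Sd Su; have [A [c [mA A0 c0 hA]]] := self_dual_ball Sd (ex_intro _ u Su).
have hu := self_dual_nonneg_on Su.
have sub : A `<=` pball `&` dcone S.
  by move=> x /hA[px hx]; split=> // z Sz; exact: le_trans (ltW c0) (hx _ Sz).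
apply: (@lt_le_trans _ _ (\int[nu]_(x in A) c%:E)%E).
  by rewrite integral_cst // mule_gt0 // lte_fin.
apply: (@le_trans _ _ (\int[nu]_(x in A) (dotp ((enorm x)^-1 *: x) u)%:E)%E).
  apply: ge0_le_integral => //.
  - by move=> x _; rewrite lee_fin ltW.
  - move=> x /hA[/andP[x0 x1] hx]; rewrite lee_fin dotpZl.
    rewrite (le_trans (hx _ Su)) // ler_peMl //; first exact: le_trans (ltW c0) (hx _ Su).
    by rewrite invf_ge1.
apply: ge0_subset_integral => //.
- exact: measurable_pball_dcone.
- by move=> x [_ Nx]; rewrite lee_fin; exact: nonneg_on_normalized Nx.
Qed.

(** By Cauchy-Schwarz the integrands differ by at most [d] at each unit vector; the bound is uniform
    in [N]. *)
Lemma cone_int_perturb N u w (d : R) : closed N -> nonneg_on N u -> nonneg_on N w ->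
  enorm (w - u) <= d -> (cone_int N u <= cone_int N w + d%:E * nu pball)%E.
Proof.
move=> cN hu hw d1.
have d0 : 0 <= d by apply: le_trans d1; exact: enorm_ge0.
have mpN := measurable_pball_closed cN.
apply: (@le_trans _ _ (cone_int N w + \int[nu]_(x in pball `&` N) d%:E)%E); last first.
  rewrite leeD2l // integral_cst // lee_wpmul2l ?lee_fin //.
  by apply: le_measure; rewrite ?inE //; exact: measurable_pball.
rewrite /cone_int -ge0_integralD //.
- apply: ge0_le_integral => //.
  + by move=> x [_ Nx]; rewrite lee_fin; exact: nonneg_on_normalized Nx.
  + by apply: emeasurable_funD => //; exact: mEFin.
  + move=> x [/andP[x0 _] Nx]; rewrite -EFinD lee_fin -lerBlDl -dotpNr -dotpDr.
    rewrite (le_trans (ler_norm _)) // (le_trans (cauchy_schwarz _ _)) //.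
    rewrite sphere_normalize ?mul1r -?enorm_gt0 //.
    by rewrite -opprB -scaleN1r enormZ normrN1 mul1r.
- by move=> x [_ Nx]; rewrite lee_fin; exact: nonneg_on_normalized Nx.
Qed.

(** * Exhaustion of a self-dual cone by its shrunken cones *)

Lemma closed_shrink S m : closed (shrink S m).
Proof.
rewrite (_ : shrink S m = \bigcap_(z in S) [set x | 0 <= dotp x z - enorm x * m.+1%:R^-1]).
  apply: closed_bigI => z _.
  apply: (@preimage_closed _ _ (fun x => dotp x z - enorm x * m.+1%:R^-1) [set r | 0 <= r]);
    last exact: closed_ge.
  move=> x _.
  apply: (@cvgB _ _ _ (nbhs x) _ (fun y => dotp y z) (fun y => enorm y * m.+1%:R^-1)).
    exact: dotp_continuous.
  apply: (@cvgM _ _ (nbhs x) _ (@enorm R n) (fun=> m.+1%:R^-1)); last exact: cvg_cst.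
  exact: enorm_continuous.
by apply/seteqP; split=> x h z Sz; have := h z Sz; rewrite /= subr_ge0.
Qed.

Lemma measurable_shrink S m : measurable (shrink S m : set (borel_rV R n)).
Proof. by apply: closed_measurable_rV; exact: closed_shrink. Qed.

Lemma shrink_normalize S m x : shrink S m x -> x != 0 -> shrink S m ((enorm x)^-1 *: x).
Proof.
move=> hx x0 z Sz; have x0' : 0 < (enorm x)^-1 by rewrite invr_gt0 enorm_gt0.
rewrite enormZ gtr0_norm // dotpZl -mulrA ler_pM2l //; exact: hx.
Qed.

Lemma shrink_sub_dcone S m : shrink S m `<=` dcone S.
Proof.
by move=> x hx z /hx; apply: le_trans; rewrite mulr_ge0 ?enorm_ge0.
Qed.

Lemma shrink_nondecreasing S m p : (m <= p)%N -> shrink S m `<=` shrink S p.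
Proof.
move=> mp x hx z /hx; apply: le_trans; rewrite ler_wpM2l ?enorm_ge0 //.
by rewrite lef_pV2 ?posrE // ler_nat.
Qed.

Lemma measurable_translate v :
  measurable_fun setT ((fun x : 'rV[R]_n => x + v) : borel_rV R n -> borel_rV R n).
Proof.
apply: (@measurability _ _ _ _ setT
  ((fun x : 'rV[R]_n => x + v) : borel_rV R n -> borel_rV R n) (@open 'rV[R]_n)) => // _ [W oW <-].
rewrite setTI; apply: open_measurable_rV.
apply: (@open_comp _ _ (fun x : 'rV[R]_n => x + v)) => // x _.
apply: (@cvgD _ _ _ (nbhs x) _ id (fun=> v)); first exact: cvg_id.
exact: cvg_cst.
Qed.

(* The part of the cone lying outside all shrunken cones has disjoint
   translates along an interior direction [s], so it is null. *)
Lemma shrink_bigcup_full S : dual S = S ->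
  nu (pball `&` dcone S `\` \bigcup_m shrink S m) = 0.
Proof.
move=> Sd; have [s ds s1] := self_dual_interior Sd.
set Z := _ `\` _; have [_ _ nushift] := nuP.
have mZ : measurable (Z : set (borel_rV R n)).
  apply: measurableD; first exact: measurable_pball_dcone.
  by apply: bigcupT_measurable => m; exact: measurable_shrink.
pose t (k : nat) : R := k.+1%:R^-1.
have t1 k : 0 < t k <= 1.
  by rewrite /t invr_gt0 ltr0n /= invf_le1 // ler1n.
pose F k := (fun x : 'rV[R]_n => x + (- (t k *: s))) @^-1` Z.
have nF k : nu (F k) = nu Z by exact: nushift.
have mF k : measurable (F k : set (borel_rV R n)).
  by rewrite -[F k]setTI; exact: measurable_translate.
(* The point of [Z] coming from [F j] is the one coming from [F i] plus (t_i - t_j) s, so its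
   products with [S] are at least [e] and it lies in some shrunken cone. *)
have disj i j (x : 'rV[R]_n) : (i < j)%N -> F i x -> F j x -> False.
  move=> ij [[pi di] ni] [_ nj]; apply: nj.
  pose e := t i - t j.
  have e0 : 0 < e by rewrite subr_gt0 /t ltf_pV2 ?posrE // ltr_nat ltnS.
  pose y := x + - (t j *: s).
  have ey z : S z -> e <= dotp y z.
    move=> Sz; have -> : y = (x + - (t i *: s)) + e *: s.
      by rewrite /y /e scalerBl; apply/rowP => l; rewrite !mxE; ring.
    rewrite dotpDl dotpZl; have := di _ Sz.
    have : e * 1 <= e * dotp s z by rewrite ler_pM2l // s1.
    lra.
  have [m hm] : exists m : nat, enorm y / e < m.+1%:R.
    exists (Num.truncn (enorm y / e)); exact: truncnS_gt.
  exists m => // z Sz; apply: le_trans (ey _ Sz).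
  rewrite ler_pdivrMr // mulrC -ler_pdivrMr //; exact: ltW.
have tF : trivIset setT F.
  apply/trivIsetP => i j _ _ ij; apply/seteqP; split=> // x [Fi Fj].
  case: (ltngtP i j) ij => // h _; [exact: (disj i j x)|exact: (disj j i x)].
have bF : (nu (\bigcup_k F k) < +oo)%E.
  apply: (@nu_bounded_lty _ (1 + enorm s)); first exact: bigcupT_measurable.
  move=> x [k _ [[/andP[_ h] _] _]].
  rewrite -(subrK (t k *: s) x) (le_trans (enormD _ _)) // lerD //.
  rewrite enormZ gtr0_norm; last by case/andP: (t1 k).
  by rewrite ler_piMl ?enorm_ge0 //; case/andP: (t1 k).
rewrite measure_bigcup // in bF.
have Zfin : nu Z \is a fin_num.
  rewrite ge0_fin_numE //; apply: (@nu_bounded_lty _ 1) => //.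
  by move=> x [[/andP[]]].
apply/eqP/negPn/negP => nz.
pose c := fine (nu Z); have nuZ : nu Z = c%:E by rewrite fineK.
have c0 : 0 < c by rewrite -lte_fin -nuZ lt0e nz measure_ge0.
(* Infinitely many disjoint copies of mass [c] would sit in a bounded set of finite measure. *)
have sum_le k : ((k%:R * c)%R%:E <= \sum_(0 <= i <oo | i \in setT) nu (F i))%E.
  have F0 i : (0 <= i)%N -> i \in setT -> (0 <= nu (F i))%E by [].
  apply: le_trans (nneseries_lim_ge k F0).
  rewrite (eq_bigl xpredT) => [|i]; last by rewrite in_setT.
  under eq_bigr do rewrite nF nuZ.
  by rewrite sumEFin sumr_const_nat subn0 mulr_natl.
move: bF sum_le; case: (\sum_(0 <= i <oo | _) _)%E => [b| |] // _ h; last first.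
  by have := h 0%N.
have := h (Num.truncn (b / c)).+1; rewrite lee_fin leNgt => /negP; apply.
by rewrite -ltr_pdivrMr // truncnS_gt.
Qed.

(** Monotone convergence along the shrunken cones, whose union fills the cone up to a null set. *)
Lemma cone_int_shrink_le S u (c : \bar R) : dual S = S -> S u ->
  (forall m, (cone_int (shrink S m) u <= c)%E) -> (cone_int (dcone S) u <= c)%E.
Proof.
move=> Sd Su hc.
have hu := self_dual_nonneg_on Su.
have mB : measurable (\bigcup_m shrink S m : set (borel_rV R n)).
  by apply: bigcupT_measurable => m; exact: measurable_shrink.
rewrite /cone_int (@ge0_negligible_integral _ _ _ nu _
  (pball `&` dcone S `\` \bigcup_m shrink S m)) //; last 4 first.
- apply: measurableD => //; exact: measurable_pball_dcone.
- exact: measurable_pball_dcone.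
- by move=> x [_ Nx]; rewrite lee_fin; exact: nonneg_on_normalized Nx.
- exact: shrink_bigcup_full.
rewrite (_ : _ `\` (_ `\` _) = \bigcup_m (pball `&` shrink S m)); last first.
  rewrite setDD -setI_bigcupr; apply/seteqP; split=> x.
    by move=> [[? ?] ?].
  by move=> [? [m _ hm]]; split; [split=> //; exact: shrink_sub_dcone hm|exists m].
have h : (cone_int (shrink S m) u @[m --> \oo] -->
    \int[nu]_(x in \bigcup_m (pball `&` shrink S m)) (dotp ((enorm x)^-1 *: x) u)%:E)%E.
  apply: ge0_nondecreasing_set_cvg_integral => //.
  - move=> m p mp; apply/subsetPset => x [px hx]; split=> //.
    exact: shrink_nondecreasing hx.
  - by move=> m; apply: measurable_pball_closed; exact: closed_shrink.
  - move=> m x [_ hx]; rewrite lee_fin; apply: nonneg_on_normalized hu _.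
    exact: shrink_sub_dcone hx.
by apply: (cvge_le _ h); apply: nearW => m; exact: hc.
Qed.

End cone_int.

(** * Existence of a minimizer *)

Section minimizer.
Variables (R : realType) (n : nat) (nu : {measure set (borel_rV R n) -> \bar R}).
Hypothesis nuP : is_rV_lebesgue nu.
Implicit Types (x y z u v w : 'rV[R]_n) (S N : set 'rV[R]_n).

Lemma sphere_delta (i : 'I_n) : sphere (delta_mx ord0 i : 'rV[R]_n).
Proof.
apply: sphere_dotp; rewrite /dotp (bigD1 i) //= big1 => [|j ji].
  by rewrite mxE !eqxx mulr1 addr0.
by rewrite mxE eqxx (negbTE ji) mulr0.
Qed.

Lemma self_dual_exists : (0 < n)%N -> exists (S : set 'rV[R]_n) u, dual S = S /\ S u.
Proof.
move=> n0; pose e : 'rV[R]_n := delta_mx ord0 (Ordinal n0).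
have se : sphere e by exact: sphere_delta.
have [||S eS Sd] := @self_dual_extension R n [set e].
- by move=> x ->.
- by move=> x y -> ->; exact: dotp_ge0.
- by exists S, e; split=> //; exact: eS.
Qed.

Lemma self_dual_cone_int_fin S u : S u -> cone_int nu (dcone S) u \is a fin_num.
Proof.
by move=> Su; apply: cone_int_fin_num => //; [exact: closed_dcone|exact: self_dual_nonneg_on].
Qed.

Lemma self_dual_minimizer : (0 < n)%N -> exists (S0 : set 'rV[R]_n) u0,
  [/\ dual S0 = S0, S0 u0 & forall S u, dual S = S -> S u ->
      (cone_int nu (dcone S0) u0 <= cone_int nu (dcone S) u)%E].
Proof.
move=> n0; pose V := [set r : R | exists S u,
  [/\ dual S = S, S u & r = fine (cone_int nu (dcone S) u)]].
have V_ge0 r : V r -> 0 <= r.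
  by move=> [S [u [Sd Su ->]]]; apply: fine_ge0; apply: cone_int_ge0; exact: self_dual_nonneg_on.
have hV : has_inf V.
  split; last by exists 0 => r; exact: V_ge0.
  by have [S [u [Sd Su]]] := self_dual_exists n0; exists (fine (cone_int nu (dcone S) u)), S, u.
pose I := inf V.
have near_inf (k : nat) : exists p : set 'rV[R]_n * 'rV[R]_n, [/\ dual p.1 = p.1, p.1 p.2 &
    fine (cone_int nu (dcone p.1) p.2) < I + k.+1%:R^-1].
  have k0 : 0 < k.+1%:R^-1 :> R by rewrite invr_gt0.
  by have [r [S [u [Sd Su ->]]] h] := inf_adherent k0 hV; exists (S, u).
have /choice[p hp] := near_inf.
(* [U] refines the filter at infinity, so 1/(k+1) is small for [U]-almost all [k]. *)
have [U [UU ooU]] := @ultraFilterLemma nat \oo _.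
pose S_ k := (p k).1; pose u_ k := (p k).2.
have Sd k : dual (S_ k) = S_ k by have [] := hp k.
have Su k : S_ k (u_ k) by have [] := hp k.
have [u0 uu0] : exists u0 : 'rV[R]_n, u_ @ U --> u0.
  by apply: (@ultra_cvg_bounded R n U 1) => k; rewrite (self_dual_sphere (Sd k) (Su k)).
pose S0 := ultralim S_ U.
have S0d : dual S0 = S0 by exact: ultralim_self_dual.
have S0u : S0 u0.
  split; last by exists u_; split=> // k; exact: self_dual_dcone.
  have h : (fun k => enorm (u_ k)) @ U --> enorm u0 by exact: enorm_cvg.
  apply/eqP; rewrite eq_le; apply/andP; split.
    by apply: (cvgr_to_le h); apply: nearW => k; rewrite (self_dual_sphere (Sd k) (Su k)).
  by apply: (cvgr_to_ge h); apply: nearW => k; rewrite (self_dual_sphere (Sd k) (Su k)).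
exists S0, u0; split=> // S u Sd' Su'.
apply: (@le_trans _ _ I%:E); last first.
  rewrite -(fineK (self_dual_cone_int_fin Su')) lee_fin; apply: ge_inf; first by case: hV.
  by exists S, u.
apply: cone_int_shrink_le => // m; apply/lee_addgt0Pr => e e0.
have pfin : nu (@pball R n) \is a fin_num.
  by rewrite ge0_fin_numE //; exact: nu_pball_lty.
pose B := fine (nu (@pball R n)).
have B0 : 0 <= B by exact: fine_ge0.
(* Chosen so that d B <= e/2; adding 1 keeps the denominator positive. *)
pose d := e / 2 / (B + 1).
have d0 : 0 < d by rewrite /d !divr_gt0 //; lra.
have U1 : U [set k | @sphere R n `&` shrink S0 m `<=` S_ k] by exact: shrink_ultralim.
have U2 : U [set k | enorm (u_ k - u0) <= d].
  have h : (fun k => enorm (u_ k - u0)) @ U --> enorm (u0 - u0).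
    by apply: enorm_cvg; apply: cvgB => //; exact: cvg_cst.
  rewrite (_ : enorm (u0 - u0) = 0) in h; last by apply/eqP; rewrite enorm_eq0 subrr.
  exact: (cvgr_le _ h d d0).
have U3 : U [set k | k.+1%:R^-1 < e / 2].
  have e20 : 0 < e / 2 by lra.
  exact: ooU (near_infty_natSinv_lt (PosNum e20)).
(* A single good index suffices: replacing [u0] by [u_ k] costs e/2, enlarging the shrunken cone to
   [dcone (S_ k)] only increases the integral, and that integral is below I + e/2. *)
have [k [[sub ud] ke]] := filter_ex (filterI (filterI U1 U2) U3).
rewrite /= in ud ke.
have sub' x : @pball R n x -> shrink S0 m x -> dcone (S_ k) x.
  move=> /andP[x0 _] hx z Sz; rewrite enorm_gt0 in x0.
  have : S_ k ((enorm x)^-1 *: x).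
    apply: sub; split; first exact: sphere_normalize.
    exact: shrink_normalize.
  move/(self_dual_dcone (Sd k))/(_ z Sz).
  by rewrite dotpZl pmulr_rge0 // invr_gt0 enorm_gt0.
have shu : nonneg_on (shrink S0 m) (u_ k).
  move=> x hx; have [->|x0] := eqVneq x 0; first by rewrite dotp0l.
  have : S_ k ((enorm x)^-1 *: x).
    apply: sub; split; first exact: sphere_normalize.
    exact: shrink_normalize.
  move/(self_dual_dcone (Sd k))/(_ _ (Su k)).
  by rewrite dotpZl pmulr_rge0 // invr_gt0 enorm_gt0.
have shu0 : nonneg_on (shrink S0 m) u0.
  by move=> x /shrink_sub_dcone; apply.
apply: (le_trans (cone_int_perturb _ _ shu0 shu ud)) => //; first exact: closed_shrink.
have -> : e = e / 2 + e / 2 by lra.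
rewrite EFinD addeA; apply: leeD.
  apply: (@le_trans _ _ (cone_int nu (dcone (S_ k)) (u_ k))).
    apply: le_cone_int => //; [exact: closed_shrink|exact: closed_dcone|
      exact: self_dual_nonneg_on|].
    by move=> x [px hx]; exact: sub'.
  rewrite -(fineK (self_dual_cone_int_fin (Su k))) lee_fin.
  have [_ _ /ltW h] := hp k; apply: le_trans h _.
  by rewrite lerD2l ltW.
rewrite -(fineK pfin) -/B -EFinM lee_fin /d.
by rewrite mulrAC ler_pdivrMr; nra.
Qed.

(** * Boundary position of the minimizing vector *)

Lemma orthogonal_exists v : (2 <= n)%N -> sphere v -> exists2 w, w != 0 & dotp v w = 0.
Proof.
move=> n2 sv; pose i := Ordinal (leq_trans (isT : (0 < 2)%N) n2); pose j := Ordinal n2.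
have dotp_delta x (k : 'I_n) : dotp x (delta_mx ord0 k) = x ord0 k.
  rewrite /dotp (bigD1 k) //= big1 => [|l lk].
    by rewrite mxE !eqxx mulr1 addr0.
  by rewrite mxE eqxx (negbTE lk) mulr0.
have [vi|vi] := eqVneq (v ord0 i) 0.
  exists (delta_mx ord0 i); last by rewrite dotp_delta.
  by rewrite -enorm_gt0 sphere_delta.
(* The quarter turn of the first two coordinates of [v]. *)
exists (v ord0 i *: delta_mx ord0 j - v ord0 j *: delta_mx ord0 i).
  apply/eqP => /rowP/(_ j)/eqP.
  by rewrite !mxE !eqxx /= mulr1 mulr0 subr0 (negbTE vi).
by rewrite !dotpE !dotp_delta; ring.
Qed.

(** If [v] were interior, the normalizations of v + e w and v - e w would lie in [S]. Both vectors
    have the same norm r > 1 and add up to 2v, so minimality and linearity give 2rJ <= 2J for the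
    positive value J at [v]. *)
Lemma minimizer_rel_boundary S v : (2 <= n)%N -> dual S = S -> S v ->
  (forall u, S u -> (cone_int nu (dcone S) v <= cone_int nu (dcone S) u)%E) -> rel_boundary S v.
Proof.
move=> n2 Sd Sv vmin; split=> //; apply: contrapT => ncl.
have [B Bv hB] : exists2 B, nbhs v B & forall x, B x -> sphere x -> S x.
  apply: contrapT => h; apply: ncl => B Bv.
  apply: contrapT => nB; apply: h; exists B => // x Bx sx.
  by apply: contrapT => nSx; apply: nB; exists x; split.
have sv := self_dual_sphere Sd Sv.
have [w w0 vw] := orthogonal_exists n2 sv.
pose f (e : R) := (enorm (v + e *: w))^-1 *: (v + e *: w).
have norm_sqr e : enorm (v + e *: w) ^+ 2 = 1 + e ^+ 2 * dotp w w.
  by rewrite enorm_sqr dotp_addZ enorm_dotp // vw; ring.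
have ww : 0 < dotp w w by rewrite lt0r dotp_eq0 w0 dotp_ge0.
have norm_gt0 e : 0 < enorm (v + e *: w).
  rewrite lt0r enorm_ge0 andbT -sqrf_eq0 norm_sqr gt_eqF //.
  by have := mulr_ge0 (sqr_ge0 e) (ltW ww); lra.
have sf e : sphere (f e) by apply: sphere_normalize; rewrite -enorm_gt0.
have f0 : f 0 = v by rewrite /f scale0r addr0 sv invr1 scale1r.
have fc : f @ (0 : R) --> v.
  have c1 : (fun e : R => v + e *: w) @ nbhs (0 : R) --> v + 0 *: w.
    apply: (@cvgD _ _ _ (nbhs (0 : R)) _ (fun=> v) (fun e => e *: w)).
      exact: cvg_cst.
    apply: (@cvgZ _ _ _ (nbhs (0 : R)) _ id (fun=> w)); first exact: cvg_id.
    exact: cvg_cst.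
  rewrite -f0; apply: (@cvgZ _ _ _ (nbhs (0 : R)) _ (fun e => (enorm (v + e *: w))^-1)
    (fun e => v + e *: w)) => //.
  apply: (@cvgV _ _ (nbhs (0 : R)) _ (fun e => enorm (v + e *: w))).
    by rewrite gt_eqF.
  exact: enorm_cvg.
have [e [e0 S1 S2]] : exists e : R, [/\ 0 < e, S (f e) & S (f (- e))].
  have /nbhs_ballP[r /= r0 hr] := fc _ Bv.
  exists (r / 2); split; first lra.
    by apply: hB; [apply: hr; rewrite /ball /= sub0r normrN gtr0_norm; lra|exact: sf].
  by apply: hB; [apply: hr; rewrite /ball /= sub0r opprK gtr0_norm; lra|exact: sf].
(* By homogeneity in [u], minimality among unit vectors becomes a bound for the unnormalized vector,
   scaled by its norm. *)
have key c : S (f c) -> nonneg_on (dcone S) (v + c *: w) /\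
    ((enorm (v + c *: w))%:E * cone_int nu (dcone S) v <= cone_int nu (dcone S) (v + c *: w))%E.
  move=> Sf; have -> : v + c *: w = enorm (v + c *: w) *: f c.
    by rewrite /f scalerA mulfV ?scale1r // gt_eqF.
  have hf := self_dual_nonneg_on Sf.
  have r0 := ltW (norm_gt0 c).
  split; first by move=> x hx; rewrite dotpZr mulr_ge0 // hf.
  rewrite cone_int_scale //; last exact: closed_dcone.
  by rewrite enormZ sf mulr1 ger0_norm // lee_wpmul2l // vmin.
have [h1 k1] := key _ S1; have [h2 k2] := key _ S2.
have hv := self_dual_nonneg_on Sv.
have : (cone_int nu (dcone S) (v + e *: w) + cone_int nu (dcone S) (v + - e *: w) =
    cone_int nu (dcone S) v + cone_int nu (dcone S) v)%E.
  rewrite -!cone_int_add //; try exact: closed_dcone.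
  by congr cone_int; rewrite scaleNr addrACA subrr addr0.
move=> h; have := leeD k1 k2; rewrite h.
have -> : enorm (v + - e *: w) = enorm (v + e *: w).
  by apply/eqP; rewrite -(@eqrXn2 _ 2) ?enorm_ge0 // !norm_sqr sqrrN.
have J0 := cone_int_gt0 nuP Sd Sv; rewrite -(fineK (self_dual_cone_int_fin Sv)) in J0 *.
rewrite -EFinM -!EFinD lee_fin lte_fin in J0 *.
have : 1 < enorm (v + e *: w).
  rewrite -(@ltr_pXn2r _ 2) ?nnegrE ?enorm_ge0 // norm_sqr expr1n.
  by have := mulr_gt0 (exprn_gt0 2 e0) ww; lra.
move: (fine _) J0 => c c0 r1; nra.
Qed.

(** * From cone integrals to the functional [Phi] *)

Lemma omega_gt0 : (0 < n)%N -> 0 < omega R n.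
Proof.
move=> n0; rewrite /omega.
have -> : @sphere R n = setT `&` @sphere R n by rewrite setTI.
rewrite (sphere_intE nuP (f := fun=> 1) (@closedT _)) //.
have [S [u [Sd Su]]] := self_dual_exists n0.
have p0 := nu_pball_gt0 nuP Sd (ex_intro _ u Su).
rewrite setIT integral_cst ?mul1e; last exact: measurable_pball.
rewrite fineM //; last by rewrite ge0_fin_numE //; exact: nu_pball_lty.
rewrite mulr_gt0 ?ltr0n //; apply: fine_gt0; rewrite p0; exact: nu_pball_lty.
Qed.

Lemma PhiE N u : closed N -> is_cone N -> nonneg_on N u ->
  Phi (N `&` @sphere R n) u = 2 / omega R n * (n%:R * fine (cone_int nu N u)).
Proof.
move=> clN coneN hu; rewrite /Phi (sphere_intE nuP (f := fun x => dotp x u)) //.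
- by rewrite fineM // cone_int_fin_num.
- exact: measurable_dotp_normalized.
- by move=> x [Nx _]; exact: hu.
Qed.

Lemma self_dualE S : dual S = S -> S = dcone S `&` @sphere R n.
Proof. by move=> Sd; rewrite -{1}Sd dualE. Qed.

(** As [dual S] lies in [S], its points have pairwise nonnegative products, so it extends to a
    self-dual [T]. Then [T] lies in the bidual of [S], hence in [S], and a nonnegative integrand has
    the smaller integral over [T]. *)
Lemma self_dual_Phi_le S u : (0 < n)%N -> classC S -> dual S u ->
  exists T : set 'rV[R]_n, [/\ dual T = T, T u & Phi T u <= Phi S u].
Proof.
move=> n0 [sectS subS] Su.
have [||T ST Td] := @self_dual_extension R n (dual S).
- by move=> x [].
- by move=> x y [_ hx] /subS; exact: hx.
have TS : T `<=` S.
  apply: subset_trans (bidual_sub sectS) => x Tx.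
  split; first exact: self_dual_sphere Tx.
  by move=> y /ST Ty; exact: (self_dual_dcone Td Tx).
have Tu : T u by exact: ST.
exists T; split=> //.
have [N [clN cvxN coneN SN]] := sectS.
have hu : nonneg_on N u.
  move=> x Nx; have [->|x0] := eqVneq x 0; first by rewrite dotp0l.
  have Sx : S ((enorm x)^-1 *: x).
    rewrite SN; split; last exact: sphere_normalize.
    by apply: coneN => //; rewrite invr_ge0 enorm_ge0.
  have := Su.2 _ Sx; rewrite dotpZr pmulr_rge0 ?invr_gt0 ?enorm_gt0 //.
  by rewrite dotpC.
rewrite SN (self_dualE Td) !PhiE //; [|exact: closed_dcone|exact: is_cone_dcone|
  exact: self_dual_nonneg_on].
rewrite ler_pM2l ?divr_gt0 ?omega_gt0 // ler_pM2l ?ltr0n //.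
apply: fine_le; [exact: self_dual_cone_int_fin|exact: cone_int_fin_num|].
apply: le_cone_int => //; first exact: closed_dcone.
move=> x [/andP[x0 _] hx]; rewrite enorm_gt0 in x0.
have := TS _ (self_dual_normalize Td hx x0); rewrite SN => -[Nx _].
have := coneN _ (enorm x) Nx (enorm_ge0 _).
by rewrite scalerA mulfV ?scale1r // enorm_eq0.
Qed.

End minimizer.

Theorem theorem3p1 (R : realType) (n : nat) : (2 <= n)%N ->
  exists (S0 : set 'rV[R]_n) (v : 'rV[R]_n),
    [/\ classC S0 /\ dual S0 v,
        (forall (S : set 'rV[R]_n) (u : 'rV[R]_n),
           classC S -> dual S u -> Phi S0 v <= Phi S u),
        0 < Phi S0 v,
        dual S0 = S0 &
        rel_boundary S0 v].
Proof.
move=> n2; have n0 : (0 < n)%N by exact: ltnW.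
have [nu nuP] := lebesgue_rV R n.
have [S0 [v [Sd Sv vmin]]] := self_dual_minimizer nuP n0.
(* On self-dual sectors [Phi] is a fixed positive multiple of [cone_int], so the minimizer carries
   over. *)
have PhiS S u : dual S = S -> S u ->
    Phi S u = 2 / omega R n * (n%:R * fine (cone_int nu (dcone S) u)).
  move=> Td Tu; rewrite {1}(self_dualE Td) (PhiE nuP) //;
    [exact: closed_dcone|exact: is_cone_dcone|exact: self_dual_nonneg_on].
have w0 := omega_gt0 nuP n0.
have n0' : 0 < n%:R :> R by rewrite ltr0n.
exists S0, v; split=> //.
- by split; [exact: self_dual_classC|rewrite Sd].
- move=> S u CS Su; have [T [Td Tu]] := self_dual_Phi_le nuP n0 CS Su.
  apply: le_trans; rewrite !PhiS // ler_pM2l ?divr_gt0 // ler_pM2l //.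
  by apply: fine_le; [exact: self_dual_cone_int_fin|exact: self_dual_cone_int_fin|exact: vmin].
- rewrite PhiS // !mulr_gt0 ?invr_gt0 //; apply: fine_gt0.
  rewrite (cone_int_gt0 nuP Sd Sv) /=; apply: (cone_int_lty nuP); first exact: closed_dcone.
  exact: self_dual_nonneg_on.
- by apply: (minimizer_rel_boundary nuP n2 Sd Sv) => u Su; exact: vmin.
Qed.
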